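(* Let $M,N$ be finitely presented $2$-parameter persistence modules, not both trivial, satisfying Property (P) with finite sets of critical values $C_M,C_N$ and Property (Q) with a finite set $\Omega$. Put $\Omega_P=\Omega\cap\mathbb{R}^2$ and $\overline{\Omega}=\Omega\cup\{[0:1:1]\}$. For every vertical line $V\subseteq\mathbb{R}^2$, there exists a line $L$ of positive slope through a point of $\overline{C}_M\cup\overline{C}_N\cup\Omega_P$ and a different point of $\overline{C}_M\cup\overline{C}_N\cup\overline{\Omega}$ such that $$\mathrm{cost}(V)\le \hat m^L\, d_B(\mathrm{dgm}\,M^L,\mathrm{dgm}\,N^L).$$ The analogous statement holds for every horizontal line $H$ in place of $V$.
   Context: **Modules.** $\mathbb{R}^2$ has the partial order $u\preceq v$ iff $u_1\le v_1$ and $u_2\le v_2$. Fix a field $\mathbb{F}$. A $2$-parameter persistence module $M$ is a functor from $(\mathbb{R}^2,\preceq)$ to $\mathbb{F}$-vector spaces, with transition maps $i_M(u,v):M_u\to M_v$ for $u\preceq v$. All modules are finitely presented. **Lines.** A line $L\subset\mathbb{R}^2$ with positive slope is parameterized as $u=\vec m s+b$, $s\in\mathbb{R}$, with $m_1,m_2>0$ and the standard normalization $\max\{m_1,m_2\}=1$, $b_1+b_2=0$. Put $\hat m^L=\min\{m_1,m_2\}$. The restriction $M^L$ is the $1$-parameter module $(M^L)_s=M_{\vec m s+b}$ with the induced maps. It decomposes as a finite direct sum of interval modules $I[b_j,d_j)$, $b_j<d_j\le\infty$; $\mathrm{dgm}\,M^L$ is the finite multiset of the points $(b_j,d_j)\in\mathbb{R}\times(\mathbb{R}\cup\{\infty\})$.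 **Bottleneck distance.** A matching between $\mathrm{dgm}\,M^L$ and $\mathrm{dgm}\,N^L$ is a multi-bijection $\sigma:P\to Q$ between multi-subsets $P\subseteq\mathrm{dgm}\,M^L$, $Q\subseteq\mathrm{dgm}\,N^L$. Its cost $c(\sigma)$ is the maximum of $\|p-\sigma(p)\|_\infty$ over $p\in P$ and of $(p_2-p_1)/2$ over the points $p=(p_1,p_2)$ of either diagram left unmatched, with $\infty-\infty=0$ and $\infty-a=\infty$ for $a\in\mathbb{R}$ (maximum over the empty set is $0$). $d_B\in[0,\infty]$ is the minimum of $c(\sigma)$ over all matchings. **Cost of vertical and horizontal lines.** For a vertical line $V$, fix $r\in V$ and let $L$ be the line through $r$ with direction $\vec m=(m_1,1)$, $0<m_1<1$; then $\mathrm{cost}(V)=\lim_{m_1\to0^+}\hat m^L d_B(\mathrm{dgm}\,M^L,\mathrm{dgm}\,N^L)$. This limit does not depend on $r\in V$. The cost of a horizontal line $H$ is defined analogously, with lines through $r\in H$ of direction $(1,m_2)$, $m_2\to0^+$. **Pushes and reciprocal position.** For $u\in\mathbb{R}^2$ and $L$ of positive slope, $L$ meets the boundary of $\{v: u\preceq v\}$ in exactly one point $\mathrm{push}_L(u)$, and $p_L(u)\in\mathbb{R}$ denotes its parameter: $\mathrm{push}_L(u)=\vec m\,p_L(u)+b$. Set $A^L_u=\{1,2\}$ if $u\in L$; $A^L_u=\{1\}$ if $\mathrm{push}_L(u)=(u_1,y)$ with $y>u_2$; $A^L_u=\{2\}$ if $\mathrm{push}_L(u)=(x,u_2)$ with $x>u_1$.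 Let $\mathbb{P}^2=\mathbb{R}^2\cup\ell_\infty$, points at infinity being written $[0:x_1:x_2]$; a line with direction $\vec m$ passes through $[0:m_1:m_2]$. For $v=[0:v_1:v_2]$ with $v_1,v_2>0$, set $A^L_v=\{1,2\}$ if $[0:m_1:m_2]=v$, $\{1\}$ if $m_2/m_1>v_2/v_1$, $\{2\}$ if $m_2/m_1<v_2/v_1$. For a set $U$ of such points, $L\sim_U L'$ iff $A^L_u=A^{L'}_u$ for all $u\in U$. **Property (P)** of $M$: there is a finite set $C_M\subset\mathbb{R}^2$ (critical values; empty iff $M$ is trivial) such that, with $\overline{C}_M$ its closure under least upper bounds, for all $u\preceq v$: $\mathrm{rank}\,i_M(u,v)=\mathrm{rank}\,i_M(\bar u,\bar v)$ where $\bar u=\max\{u'\in\overline{C}_M: u'\preceq u\}$ and $\bar v=\max\{v'\in\overline{C}_M:v'\preceq v\}$, if $\{u'\in\overline{C}_M:u'\preceq u\}\ne\emptyset$, and $\mathrm{rank}\,i_M(u,v)=0$ otherwise. **Property (Q)** of $M,N$ (with given $C_M,C_N$): there is a finite set $\Omega=\Omega(C_M,C_N)\subset\mathbb{P}^2$, whose points at infinity are of the form $[0:v_1:v_2]$ with $v_1,v_2>0$, such that for all $u,v,w,x\in\overline{C}_M\cup\overline{C}_N$ and $\delta,\eta\in\{1,2\}$ (not necessarily distinct), the sign (positive, negative or zero) of $\frac{|p_L(u)-p_L(v)|}{\delta}-\frac{|p_L(w)-p_L(x)|}{\eta}$ is the same for all lines $L$ of positive slope in the same $\sim_{\overline{C}_M\cup\overline{C}_N\cup\Omega}$-equivalence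 class. *)

(* Defs.v *)
From HB Require Import structures.
From mathcomp Require Import all_boot all_order all_algebra.
From mathcomp Require Import all_classical all_reals all_analysis.
From mathcomp Require Import lra.
Set Implicit Arguments.
Unset Strict Implicit.
Unset Printing Implicit Defensive.
Import Order.TTheory GRing.Theory Num.Theory.
Import numFieldNormedType.Exports.
(* Equips [R * R] with the coordinatewise order and its lattice operations. *)
Export Order.DefaultProdOrder.
Local Open Scope classical_set_scope.
Local Open Scope ring_scope.

(* The spaces are finite-dimensional ([vectType]): the values of a finitely
   presented module always are. *)
Record pmodule d (T : porderType d) (F : fieldType) := PModule {
  pobj : T -> vectType F;
  pmap : forall u v : T, (u <= v)%O -> 'Hom(pobj u, pobj v);
  pmap_id : forall (u : T) (uu : (u <= u)%O), pmap uu = \1%VF;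
  pmap_comp : forall (u v w : T) (uv : (u <= v)%O) (vw : (v <= w)%O)
    (uw : (u <= w)%O), pmap uw = (pmap vw \o pmap uv)%VF
}.

Arguments pobj {d T F} M u : rename.
Arguments pmap {d T F} M {u v} uv : rename.

Record pmorphism d (T : porderType d) (F : fieldType) (M N : pmodule T F) :=
  PMorphism {
  pmor : forall u : T, 'Hom(pobj M u, pobj N u);
  pmor_natural : forall (u v : T) (uv : (u <= v)%O),
    (pmap N uv \o pmor u)%VF = (pmor v \o pmap M uv)%VF
}.

Arguments pmor {d T F M N} f u : rename.

Definition pisomorphic d (T : porderType d) (F : fieldType)
    (M N : pmodule T F) : Prop :=
  exists f : pmorphism M N, forall u : T, bijective (pmor f u).

Definition ptrivial d (T : porderType d) (F : fieldType) (M : pmodule T F) :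
    Prop :=
  forall u : T, \dim {: pobj M u} = 0%N.

Definition prank d (T : porderType d) (F : fieldType) (M : pmodule T F)
    (u v : T) (uv : (u <= v)%O) : nat :=
  \dim (limg (pmap M uv)).

Section Constructions.
Context d (T : porderType d) (F : fieldType).

Definition convex_pred (S : pred T) : Prop :=
  forall u v w : T, (u <= v)%O -> (v <= w)%O -> S u -> S w -> S v.

Section Indicator.
Variables (S : pred T) (cS : convex_pred S).

(* F on S and 0 off S; [S u : bool] is coerced to the dimension 0 or 1, and
   [pid_mx 1] is the identity between two points of S. *)
Definition ind_obj (u : T) : vectType F := 'rV[F]_(S u).

Definition ind_map (u v : T) (uv : (u <= v)%O) : 'Hom(ind_obj u, ind_obj v) :=
  linfun (mulmxr (pid_mx 1 : 'M[F]_(S u, S v))).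

Lemma ind_map_id (u : T) (uu : (u <= u)%O) : ind_map uu = \1%VF.
Proof.
apply/lfunP => x; rewrite /ind_map lfunE id_lfunE /=.
move: x; rewrite /ind_obj; case: (S u) => x;
  last by rewrite [x]thinmx0 mul0mx.
by rewrite pid_mx_1 mulmx1.
Qed.

Lemma ind_map_comp (u v w : T) (uv : (u <= v)%O) (vw : (v <= w)%O)
  (uw : (u <= w)%O) : ind_map uw = (ind_map vw \o ind_map uv)%VF.
Proof.
apply/lfunP => x; rewrite /ind_map comp_lfunE !lfunE /= -mulmxA.
congr (x *m _); move: (cS uv vw); clear.
case: (S u) => [|_]; last by rewrite [LHS]flatmx0 [RHS]flatmx0.
case: (S w) => [|_]; last by rewrite [LHS]thinmx0 [RHS]thinmx0.
by move=> -> //; rewrite mul_pid_mx.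
Qed.

Definition pindicator : pmodule T F := PModule ind_map_id ind_map_comp.

End Indicator.

Definition pzero : pmodule T F :=
  @pindicator xpred0 (fun _ _ _ _ _ _ h => h).

Section Sum.
Variables M N : pmodule T F.

Definition sum_fun (u v : T) (uv : (u <= v)%O)
    (x : (pobj M u * pobj N u)%type) : (pobj M v * pobj N v)%type :=
  (pmap M uv x.1, pmap N uv x.2).

Lemma sum_fun_linear (u v : T) (uv : (u <= v)%O) : linear (sum_fun uv).
Proof. by move=> a x y; rewrite /sum_fun /= !linearP. Qed.

HB.instance Definition _ (u v : T) (uv : (u <= v)%O) :=
  GRing.isLinear.Build F (pobj M u * pobj N u)%type (pobj M v * pobj N v)%type
    _ (sum_fun uv) (sum_fun_linear uv).

Definition sum_map (u v : T) (uv : (u <= v)%O) :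
    'Hom((pobj M u * pobj N u)%type, (pobj M v * pobj N v)%type) :=
  linfun (sum_fun uv).

Lemma sum_map_id (u : T) (uu : (u <= u)%O) : sum_map uu = \1%VF.
Proof.
apply/lfunP => -[x y]; rewrite /sum_map lfunE id_lfunE /= /sum_fun /=.
by rewrite !pmap_id !id_lfunE.
Qed.

Lemma sum_map_comp (u v w : T) (uv : (u <= v)%O) (vw : (v <= w)%O)
  (uw : (u <= w)%O) : sum_map uw = (sum_map vw \o sum_map uv)%VF.
Proof.
apply/lfunP => x; rewrite /sum_map comp_lfunE !lfunE /= /sum_fun /=.
by rewrite (pmap_comp M uv vw uw) (pmap_comp N uv vw uw) !comp_lfunE.
Qed.

Definition pdsum2 : pmodule T F := PModule sum_map_id sum_map_comp.

End Sum.

Definition pdsum (s : seq (pmodule T F)) : pmodule T F := foldr pdsum2 pzero s.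

Lemma upset_convex (a : T) : convex_pred (fun u => (a <= u)%O).
Proof. by move=> u v w uv _ au _; exact: le_trans au uv. Qed.

Definition pfree (gs : seq T) : pmodule T F :=
  pdsum [seq pindicator (@upset_convex g) | g <- gs].

(* M is the cokernel of a morphism between finitely generated free modules *)
Definition finitely_presented (M : pmodule T F) : Prop :=
  exists (gs rs : seq T) (p : pmorphism (pfree rs) (pfree gs))
    (q : pmorphism (pfree gs) M),
    forall u : T, limg (pmor q u) = fullv /\ lker (pmor q u) = limg (pmor p u).

End Constructions.

Notation bimodule R F := (pmodule (R * R)%type F).

Section Diagrams.
Context (R : realType) (F : fieldType).
Local Open Scope ereal_scope.

Definition interval_pred (p : R * \bar R) : pred R :=
  fun s => (p.1 <= s)%R && (s%:E < p.2).

Lemma interval_convex (p : R * \bar R) : convex_pred (interval_pred p).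
Proof.
move=> u v w uv vw /andP[pu _] /andP[_ wp]; apply/andP; split.
  exact: le_trans pu uv.
by apply: le_lt_trans wp; rewrite lee_fin.
Qed.

Definition pinterval (p : R * \bar R) : pmodule R F :=
  pindicator F (@interval_convex p).

Definition is_dgm (M : pmodule R F) (s : seq (R * \bar R)) : Prop :=
  (forall p, p \in s -> p.1%:E < p.2) /\
  pisomorphic M (pdsum [seq pinterval p | p <- s]).

(* A multiset is represented by a list in arbitrary order. The default [::]
   is never used for the restriction of a finitely presented module. *)
Definition dgm (M : pmodule R F) : seq (R * \bar R) :=
  xget [::] [set s | is_dgm M s].

End Diagrams.

Section Bottleneck.
Context (R : realType).
Local Open Scope ereal_scope.
Implicit Types (p q : R * \bar R) (A B : seq (R * \bar R)).

(* |x - y| with the convention oo - oo = 0, which differs from that of \bar R *)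
Definition coord_dist (x y : \bar R) : \bar R := if x == y then 0 else `|x - y|.

Definition pt_dist p q : \bar R :=
  maxe (coord_dist p.1%:E q.1%:E) (coord_dist p.2 q.2).

Definition half_pers p : \bar R := (p.2 - p.1%:E) * (2^-1)%:E.

(* A matching is a partial injection between the indices of the two lists. *)
Definition is_matching n m (s : {ffun 'I_n -> option 'I_m}) : bool :=
  [forall i, forall j, (s i != None) && (s i == s j) ==> (i == j)].

Definition matching_cost A B (s : {ffun 'I_(size A) -> option 'I_(size B)}) :
    \bar R :=
  maxe
    (\big[maxe/0]_(i < size A)
       match s i with
       | Some j => pt_dist (tnth (in_tuple A) i) (tnth (in_tuple B) j)
       | None => half_pers (tnth (in_tuple A) i)
       end)
    (\big[maxe/0]_(j < size B | [forall i, s i != Some j])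
       half_pers (tnth (in_tuple B) j)).

(* The empty matching exists, so the default +oo does not affect the minimum. *)
Definition bottleneck A B : \bar R :=
  \big[mine/+oo]_(s : {ffun 'I_(size A) -> option 'I_(size B)} | is_matching s)
    matching_cost s.

End Bottleneck.

Record posline (R : realType) := PosLine {
  ldir : R * R;
  lbase : R * R;
  ldir1_gt0 : 0 < ldir.1;
  ldir2_gt0 : 0 < ldir.2;
  ldir_max : Num.max ldir.1 ldir.2 = 1;
  lbase_sum : lbase.1 + lbase.2 = 0
}.

Section Lines.
Context (R : realType).
Implicit Types (L : posline R) (u r : R * R).

Definition lpoint L (s : R) : R * R :=
  ((ldir L).1 * s + (lbase L).1, (ldir L).2 * s + (lbase L).2).

Definition on_line L u : Prop := exists s, lpoint L s = u.

Definition mhat L : R := Num.min (ldir L).1 (ldir L).2.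

Lemma lpoint_homo L (s t : R) : s <= t -> (lpoint L s <= lpoint L t)%O.
Proof.
move=> st; rewrite leEprod /= !lerD2r.
by rewrite !ler_wpM2l // ltW ?ldir1_gt0 ?ldir2_gt0.
Qed.

Section Through.
Variables (r m : R * R).
Hypotheses (m1_gt0 : 0 < m.1) (m2_gt0 : 0 < m.2) (m_max : Num.max m.1 m.2 = 1).

(* The point r has parameter (r.1 + r.2) / (m.1 + m.2), as b.1 + b.2 = 0. *)
Let s := (r.1 + r.2) / (m.1 + m.2).

Lemma through_base_sum : (r.1 - m.1 * s) + (r.2 - m.2 * s) = 0.
Proof.
rewrite addrACA -opprD -mulrDl mulrC divfK ?subrr //.
by rewrite gt_eqF // addr_gt0.
Qed.

Definition line_through : posline R :=
  @PosLine R m (r.1 - m.1 * s, r.2 - m.2 * s)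
    m1_gt0 m2_gt0 m_max through_base_sum.

Lemma on_line_through : on_line line_through r.
Proof. by exists s; rewrite /lpoint /= ![_ * _ + _]addrC !subrK; case: r. Qed.

End Through.

(* Totalizes the slope parameter; only values in ]0, 1[ matter for the limits
   at 0^+ below. *)
Definition clamp (t : R) : R := if 0 < t < 1 then t else 1.

Lemma clamp_gt0 t : 0 < clamp t.
Proof. by rewrite /clamp; case: ifP => // /andP[]. Qed.

Lemma clamp_le1 t : clamp t <= 1.
Proof. by rewrite /clamp; case: ifP => // /andP[_ /ltW]. Qed.

Lemma clamp_max_l t : Num.max (clamp t) 1 = 1.
Proof. exact/max_idPr/clamp_le1. Qed.

Lemma clamp_max_r t : Num.max 1 (clamp t) = 1.
Proof. exact/max_idPl/clamp_le1. Qed.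

Definition steep_line r (t : R) : posline R :=
  @line_through r (clamp t, 1) (clamp_gt0 t) ltr01 (clamp_max_l t).

Definition flat_line r (t : R) : posline R :=
  @line_through r (1, clamp t) ltr01 (clamp_gt0 t) (clamp_max_r t).

End Lines.

Section Restriction.
Context (R : realType) (F : fieldType) (M : bimodule R F) (L : posline R).

Definition restr_map (s t : R) (st : s <= t) :
    'Hom(pobj M (lpoint L s), pobj M (lpoint L t)) :=
  pmap M (lpoint_homo L st).

Lemma restr_map_id (s : R) (ss : s <= s) : restr_map ss = \1%VF.
Proof. by rewrite /restr_map pmap_id. Qed.

Lemma restr_map_comp (s t w : R) (st : s <= t) (tw : t <= w) (sw : s <= w) :
  restr_map sw = (restr_map tw \o restr_map st)%VF.
Proof. exact: pmap_comp. Qed.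

Definition restr : pmodule R F := PModule restr_map_id restr_map_comp.

End Restriction.

Section Cost.
Context (R : realType) (F : fieldType) (M N : bimodule R F).
Local Open Scope ereal_scope.

Definition weighted_dist (L : posline R) : \bar R :=
  (mhat L)%:E * bottleneck (dgm (restr M L)) (dgm (restr N L)).

(* Cost of the vertical, resp. horizontal, line through r: the choice of r on
   that line does not matter. *)
Definition cost_vertical (r : R * R) : \bar R :=
  lim (weighted_dist (steep_line r t) @[t --> (0%R : R)^'+]).

Definition cost_horizontal (r : R * R) : \bar R :=
  lim (weighted_dist (flat_line r t) @[t --> (0%R : R)^'+]).

End Cost.

(* The points at infinity are listed by normal forms: [Inf t] is [0:1:t] and
   [InfVert] is [0:0:1]. *)
Inductive ppoint (R : realType) :=
  | Aff of R * R
  | Inf of R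
  | InfVert.

Arguments InfVert {R}.

Section Reciprocal.
Context (R : realType).
Implicit Types (L : posline R) (u : R * R) (P : ppoint R).

(* The point [0:x1:x2], for (x1, x2) <> (0, 0). *)
Definition pinf (x1 x2 : R) : ppoint R :=
  if x1 == 0 then InfVert else Inf (x2 / x1).

Definition passes_through L P : Prop :=
  match P with
  | Aff u => on_line L u
  | _ => P = pinf (ldir L).1 (ldir L).2
  end.

Definition boundary (T : topologicalType) (A : set T) : set T :=
  closure A `\` interior A.

Definition push_param L u : R :=
  xget 0 [set s | boundary [set v : R * R | (u <= v)%O] (lpoint L s)].

Lemma boundary_upset u (v : R * R) :
  boundary [set w : R * R | (u <= w)%O] v <->
  (u <= v)%O /\ (v.1 = u.1 \/ v.2 = u.2).
Proof.
have -> : [set w : R * R | (u <= w)%O] =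
    fst @^-1` [set x | u.1 <= x] `&` snd @^-1` [set x | u.2 <= x].
  by apply/seteqP; split => w /=; rewrite leEprod => /andP.
have cl : closed (fst @^-1` [set x : R | u.1 <= x] `&` snd @^-1` [set x : R| u.2 <= x]).
  apply: closedI; apply: preimage_closed; try exact: closed_ge.
    by move=> z _; apply: cvg_fst.
  by move=> z _; apply: cvg_snd.
rewrite /boundary -(closure_id _).1 // leEprod; split.
- move=> [/= [h1 h2] hi]; split; first exact/andP.
  apply: contrapT => /not_orP [n1 n2]; apply: hi.
  have l1 : u.1 < v.1 by rewrite lt_neqAle h1 andbT eq_sym; apply/eqP.
  have l2 : u.2 < v.2 by rewrite lt_neqAle h2 andbT eq_sym; apply/eqP.
  exists ([set x | u.1 < x], [set x | u.2 < x]) => /=.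
    by split; apply: open_nbhs_nbhs; split => //; apply: open_gt.
  by move=> z /= [/ltW ? /ltW].
- move=> [/andP[h1 h2] h]; split => // -[[A B] /= [nA nB] sub].
  case: h => h.
    have [e e0 /(_ (v.1 - e/2)) hA] := nA.
    have/sub/= [+ _] : (A `*` B) (v.1 - e/2, v.2).
      split => /=; last exact: nbhs_singleton.
      by apply: hA; rewrite /= opprB addrC subrK gtr0_norm; have:= e0 : 0 < e; lra.
    by rewrite h; have:= e0 : 0 < e; lra.
  have [e e0 /(_ (v.2 - e/2)) hB] := nB.
  have/sub/= [_] : (A `*` B) (v.1, v.2 - e/2).
    split => /=; first exact: nbhs_singleton.
    by apply: hB; rewrite /= opprB addrC subrK gtr0_norm; have:= e0 : 0 < e; lra.
  by rewrite h; have:= e0 : 0 < e; lra.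
Qed.

Lemma push_paramE L u :
  push_param L u = Num.max ((u.1 - (lbase L).1) / (ldir L).1)
                           ((u.2 - (lbase L).2) / (ldir L).2).
Proof.
have m1 := ldir1_gt0 L; have m2 := ldir2_gt0 L.
apply: xget_unique => /=.
  apply/boundary_upset; rewrite leEprod /= -!lerBlDr.
  rewrite ![_ * Num.max _ _]mulrC -!ler_pdivrMr // !le_max !lexx orbT; split=> //.
  case: leP => _; [right|left]; by rewrite divfK ?subrK// gt_eqF.
move=> s /boundary_upset; rewrite leEprod /= -!lerBlDr ![_ * s]mulrC -!ler_pdivrMr //.
move=> [/andP[h1 h2] h]; apply/eqP; rewrite eq_le ge_max h1 h2 /= andbT le_max.
by case: h => <-; rewrite addrK mulfK ?gt_eqF// lexx ?orbT.
Qed.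

Definition push L u : R * R := lpoint L (push_param L u).

(* For [Inf t] = [0:1:t] the definition is meant for t > 0; [InfVert] does not
   occur in the sets to which reciprocal position is applied. *)
Definition recip L P : set nat :=
  match P with
  | Aff u =>
      if `[< on_line L u >] then [set 1%N; 2%N]
      else if ((push L u).1 == u.1) && (u.2 < (push L u).2) then [set 1%N]
      else if ((push L u).2 == u.2) && (u.1 < (push L u).1) then [set 2%N]
      else set0
  | Inf t =>
      if (ldir L).2 / (ldir L).1 == t then [set 1%N; 2%N]
      else if t < (ldir L).2 / (ldir L).1 then [set 1%N]
      else [set 2%N]
  | InfVert => set0
  end.

Definition recip_equiv (U : set (ppoint R)) L L' : Prop :=
  forall P, U P -> recip L P = recip L' P.

Definition lub_closure (C : set (R * R)) : set (R * R) :=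
  smallest [set D | forall u v, D u -> D v -> D (Order.join u v)] C.

Definition is_max (A : set (R * R)) u : Prop := A u /\ ubound A u.

Definition below (C : set (R * R)) u : set (R * R) :=
  [set u' | lub_closure C u' /\ (u' <= u)%O].

Definition property_P (F : fieldType) (M : bimodule R F) (C : set (R * R)) :
    Prop :=
  [/\ finite_set C,
      C = set0 <-> ptrivial M,
      forall u v (uv : (u <= v)%O), below C u !=set0 ->
        exists (bu bv : R * R) (buv : (bu <= bv)%O),
          [/\ is_max (below C u) bu, is_max (below C v) bv &
              prank M uv = prank M buv] &
      forall u v (uv : (u <= v)%O), below C u = set0 -> prank M uv = 0%N].

Definition crit (CM CN : set (R * R)) : set (R * R) :=
  lub_closure CM `|` lub_closure CN.

Definition property_Q (CM CN : set (R * R)) (Omega : set (ppoint R)) : Prop :=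
  [/\ finite_set Omega,
      forall P, Omega P -> (exists u, P = Aff u) \/
        (exists v1 v2, [/\ 0 < v1, 0 < v2 & P = pinf v1 v2]) &
      forall u v w x (delta eta : nat),
        crit CM CN u -> crit CM CN v -> crit CM CN w -> crit CM CN x ->
        delta \in [:: 1; 2]%N -> eta \in [:: 1; 2]%N ->
        forall L L', recip_equiv (@Aff R @` crit CM CN `|` Omega) L L' ->
          let diff K := `|push_param K u - push_param K v| / delta%:R
                        - `|push_param K w - push_param K x| / eta%:R in
          Num.sg (diff L) = Num.sg (diff L')].

Definition candidate_line (CM CN : set (R * R)) (Omega : set (ppoint R)) L :
    Prop :=
  exists P Q,
    [/\ (@Aff R @` crit CM CN `|` (Omega `&` range (@Aff R))) P,
        (@Aff R @` crit CM CN `|` (Omega `|` [set pinf 1 1])) Q,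
        P <> Q, passes_through L P & passes_through L Q].

End Reciprocal.

(* Main.v *)
From Pilot Require Import Defs.
From mathcomp Require Import all_boot all_order all_algebra.
From mathcomp Require Import all_classical all_reals all_analysis.
From HB Require Import structures.
From mathcomp Require Import ring lra.
(* Again, because [seq.pmap] has come to shadow the transition maps [pmap]. *)
Import Pilot.Defs.
Set Implicit Arguments.
Unset Strict Implicit.
Unset Printing Implicit Defensive.
Import Order.TTheory GRing.Theory Num.Theory.
Import numFieldNormedType.Exports.
Local Open Scope classical_set_scope.
Local Open Scope ring_scope.

(* Write a steep line as c1 = a + h * c2 with 0 < h <= 1; up to an additive
   constant, h times the parameter of the push of u is
   max (c1 u - a) (h * c2 u), which still makes sense for the vertical line
   h = 0. Fix which points of W (the critical points and the affine part of
   Omega) lie to the left of the line. In the (a, h)-plane this cuts out a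
   convex polygon, a cell, on which the valuations of the points of W are
   affine; by property Q the weighted bottleneck distance is, on the whole
   closed cell, h = 0 included, a single term |lval u - lval v| / delta (or
   infinite). Unless that term is constant or vanishes at the vertical line,
   it is a linear functional, so it can be increased by sliding the line to the
   left until it meets a point w of W, and then rotating it about w. The
   rotation stops at a second point of W or at an extreme slope, which gives a
   candidate line, or else at the vertical line through w. The latter has cost
   at least that of the original line and fewer points of W to its left, so
   one concludes by induction. *)

(** * Interval decomposition of tame one-parameter modules *)

(** Property Q concerns absolute differences and lines of positive slope, so it is usable only on
    open cells. Claims about boundary lines, the vertical one included, are limits along a segment
    into the open cell, and comparisons survive there only weakly: distinct values may merge and
    bars may shrink to the diagonal. Diagrams are therefore carried symbolically, with critical
    points as endpoints, and the bottleneck distance is shown to ignore diagonal points. A vertical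
    line has no restricted module. Its value is defined through ranks, which depend on a valuation
    only through its sublevel sets and so make sense at h = 0. That definition mentions no cell, so
    all cells touching a vertical line give it the same value; the induction relies on this when it
    changes cells. As [dgm] is a choice with a default, interval decompositions of the restrictions
    have to be constructed; property P lets ranks change only at pushes of critical points. The
    point [0:1:1] caps h at 1, the range in which h is the weight of the line. *)

Section Ranks.
Context d (T : porderType d) (F : fieldType).
Implicit Types M N : pmodule T F.

(** The value 0 off the order makes transition maps a total function of their endpoints, so no order
    proofs have to be carried. *)
Definition ptrans M (u v : T) : 'Hom(pobj M u, pobj M v) :=
  match @idP (u <= v)%O with ReflectT h => pmap M h | ReflectF _ => 0 end.

Lemma ptransE M u v (uv : (u <= v)%O) : ptrans M u v = pmap M uv.
Proof.
rewrite /ptrans; case: {-}_ / idP => [h|/(_ uv)//].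
by rewrite (bool_irrelevance h uv).
Qed.

Lemma ptrans_id M u x : ptrans M u u x = x.
Proof. by rewrite (ptransE M (lexx u)) pmap_id id_lfunE. Qed.

Lemma ptrans_trans M u v w x : (u <= v)%O -> (v <= w)%O ->
  ptrans M v w (ptrans M u v x) = ptrans M u w x.
Proof.
move=> uv vw; rewrite (ptransE M uv) (ptransE M vw) (ptransE M (le_trans uv vw)).
by rewrite (pmap_comp M uv vw) comp_lfunE.
Qed.

Lemma prank_iso M N u v (uv : (u <= v)%O) :
  pisomorphic M N -> prank M uv = prank N uv.
Proof.
move=> [f bij]; rewrite /prank.
have inj w : (fullv :&: lker (pmor f w) = 0)%VS.
  by apply/eqP; rewrite capfv; apply/lker0P/bij_inj.
have sur w : limg (pmor f w) = fullv.
  apply/vspaceP => y; rewrite memvf; have [g _ fg] := bij w.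
  by rewrite -(fg y) memv_img ?memvf.
rewrite -(sur u) -limg_comp (pmor_natural f uv) limg_comp.
rewrite (@limg_dim_eq _ _ _ (pmor f v)) //.
by apply/eqP; rewrite -subv0 -(inj v) capvS ?subvf.
Qed.

Lemma prank_sum M N u v (uv : (u <= v)%O) :
  prank (pdsum2 M N) uv = (prank M uv + prank N uv)%N.
Proof.
rewrite /prank /=.
set A := pobj M v; set B := pobj N v.
have il : linear (fun x : A => (x, 0) : (A * B)%type).
  by move=> a x y; apply: injective_projections; rewrite /= ?scaler0 ?addr0.
have ir : linear (fun x : B => (0, x) : (A * B)%type).
  by move=> a x y; apply: injective_projections; rewrite /= ?scaler0 ?addr0.
pose iL := GRing.isLinear.Build F A (A * B)%type _ _ il.
pose iR := GRing.isLinear.Build F B (A * B)%type _ _ ir.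
pose fl : {linear A -> (A * B)%type} := HB.pack (fun x : A => (x, 0) : (A * B)%type) iL.
pose fr : {linear B -> (A * B)%type} := HB.pack (fun x : B => (0, x) : (A * B)%type) iR.
have -> : limg (sum_map M N uv) =
    (linfun fl @: limg (pmap M uv) + linfun fr @: limg (pmap N uv))%VS.
  apply/vspaceP => -[x y]; apply/idP/idP.
    move=> /memv_imgP[[a b] _ ->]; rewrite /sum_map lfunE /= /sum_fun /=.
    have -> : (pmap M uv a, pmap N uv b) =
        linfun fl (pmap M uv a) + linfun fr (pmap N uv b).
      by rewrite !lfunE /=; congr (_, _); rewrite ?addr0 ?add0r.
    by rewrite memv_add ?memv_img ?memvf.
  move=> /memv_addP[p /memv_imgP[p' /memv_imgP[a _ ->] ->]].
  move=> [q /memv_imgP[q' /memv_imgP[b _ ->] ->] ->].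
  have -> : linfun fl (pmap M uv a) + linfun fr (pmap N uv b) =
      sum_map M N uv (a, b).
    by rewrite !lfunE /= /sum_fun /=; congr (_, _); rewrite ?addr0 ?add0r.
  by rewrite memv_img ?memvf.
have fl0 : lker (linfun fl) == 0%VS.
  by apply/lker0P => x y; rewrite !lfunE /= => -[].
have fr0 : lker (linfun fr) == 0%VS.
  by apply/lker0P => x y; rewrite !lfunE /= => -[].
rewrite dimv_disjoint_sum; last first.
  apply/eqP; rewrite -subv0; apply/subvP => z /memv_capP[].
  move=> /memv_imgP[a _ ->] /memv_imgP[b _].
  by rewrite !lfunE /= memv0 => -[-> _].
by rewrite (@limg_dim_eq _ _ _ (linfun fl)) ?(@limg_dim_eq _ _ _ (linfun fr)) //
  ?(eqP fl0) ?(eqP fr0) capv0.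
Qed.

Lemma rank_pid_mx1 (a b : bool) :
  \dim (limg (linfun (mulmxr (pid_mx 1 : 'M[F]_(a, b)))
    : 'Hom('rV[F]_a, 'rV[F]_b))) = a && b :> nat.
Proof.
have dim0 (m : nat) (U : {vspace 'rV[F]_m}) : (\dim U <= m)%N.
  by apply: leq_trans (dimvS (subvf _)) _; rewrite dimvf /dim /= mul1n.
case: b => /=; last by rewrite andbF; apply/eqP; rewrite -leqn0 dim0.
case: a => /=.
  set f := linfun _; apply/eqP; rewrite eqn_leq dim0 lt0n dimv_eq0.
  apply/eqP => im0; have : f (const_mx 1) \in limg f by rewrite memv_img ?memvf.
  rewrite im0 memv0 lfunE /= pid_mx_1 mulmx1 => /eqP/matrixP/(_ 0 0).
  by rewrite !mxE => /eqP; rewrite oner_eq0.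
apply/eqP; rewrite -leqn0 leqn0 dimv_eq0 -subv0.
apply/subvP => y /memv_imgP[x _ ->].
by rewrite (thinmx0 x) linear0 mem0v.
Qed.

Lemma prank_indicator (S : pred T) (cS : convex_pred S) u v (uv : (u <= v)%O) :
  prank (pindicator F cS) uv = S u && S v :> nat.
Proof. exact: rank_pid_mx1. Qed.

End Ranks.

Section RankDiagram.
Context (R : realType) (F : fieldType).

Lemma prank_pdsum_interval (s : seq (R * \bar R)) (a b : R) (ab : (a <= b)%O) :
  prank (pdsum [seq pinterval F p | p <- s]) ab =
  count (fun p => (p.1 <= a) && (b%:E < p.2)%E) s.
Proof.
elim: s => [|p s IH] /=; first exact: prank_indicator.
rewrite prank_sum IH prank_indicator /interval_pred; congr (nat_of_bool _ + _)%N.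
have [pa|] //= := boolP (p.1 <= a); rewrite (le_trans pa ab) /=.
have [bp|] := boolP (b%:E < p.2)%E; rewrite ?andbF // andbT.
by apply: le_lt_trans bp; rewrite lee_fin.
Qed.

End RankDiagram.

Section FiniteExtrema.
Context (R : realType).
Implicit Types (l : seq R) (P : pred R).

Lemma ex_min_in l P : has P l ->
  exists b, [/\ b \in l, P b & forall c, c \in l -> P c -> b <= c].
Proof.
elim: l => //= a l IH; have [/IH[b [bl Pb bmin]] _|nPl] := boolP (has P l).
  have [Pa|nPa] := boolP (P a); last first.
    exists b; split=> [||c]; rewrite ?inE ?bl ?orbT // => /orP[/eqP->|]; last exact: bmin.
    by rewrite (negPf nPa).
  have [ab|/ltW ba] := leP a b.
    exists a; split=> [||c]; rewrite ?inE ?eqxx // => /orP[/eqP->//|cl Pc].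
    exact: le_trans ab (bmin c cl Pc).
  exists b; split=> [||c]; rewrite ?inE ?bl ?orbT // => /orP[/eqP->//|].
  exact: bmin.
rewrite orbF => Pa; exists a; split=> [||c]; rewrite ?inE ?eqxx // => /orP[/eqP->//|cl Pc].
by case/hasP: nPl; exists c.
Qed.

Lemma ex_max_in l P : has P l ->
  exists b, [/\ b \in l, P b & forall c, c \in l -> P c -> c <= b].
Proof.
move=> hP; have [|b [bl Pb bmin]] := @ex_min_in [seq - x | x <- l] (P \o -%R).
  by rewrite has_map; apply: sub_has hP => x /=; rewrite opprK.
exists (- b); split=> // [|c cl Pc]; last first.
  by rewrite lerNr bmin ?map_f //= opprK.
by move: bl => /mapP[x xl ->]; rewrite opprK.
Qed.

End FiniteExtrema.

Section IntervalDecomposition.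
Context (R : realType) (F : fieldType) (M : pmodule R F).

(** The data of a map from an interval module to [M]: birth, image of the generator, death. *)
Definition bar := {b : R & (pobj M b * \bar R)%type}.

Definition bar_pt (x : bar) : R * \bar R := (tag x, (tagged x).2).

Definition bar_vec (s : R) (x : bar) : pobj M s :=
  ptrans M (tag x) s (tagged x).1.

Definition frame (X : seq bar) (s : R) : seq (pobj M s) :=
  [seq bar_vec s x | x <- X & interval_pred (bar_pt x) s].

Definition bar_on (ts : seq R) (x : bar) : bool :=
  [&& tag x \in ts, (tagged x).2 \in +oo%E :: [seq t%:E | t <- ts],
      ((tag x)%:E < (tagged x).2)%E &
      all (fun t => ((tagged x).2 <= t%:E)%E ==> (bar_vec t x == 0)) ts].

Lemma basis_of_cons (vT : vectType F) (K K' : {vspace vT}) x X :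
  K = (<[x]> + K')%VS -> x \notin K' -> basis_of K' X -> basis_of K (x :: X).
Proof.
move=> KE xK' /andP[/eqP sX fX]; rewrite /basis_of span_cons free_cons sX xK' fX.
by rewrite KE eqxx.
Qed.

(* The bar of a nonzero vector at the lowest nonzero level always splits off,
   since nothing maps into that level. *)
Lemma subfamily_frame (ts : seq R) (K : forall s, {vspace pobj M s}) :
  (forall s t, s \in ts -> t \in ts -> s <= t -> (ptrans M s t @: K s <= K t)%VS) ->
  exists X : seq bar, all (bar_on ts) X /\
    forall s, s \in ts -> basis_of (K s) (frame X s).
Proof.
have [n] := ubnP (\sum_(t <- ts) \dim (K t)).
elim: n K => // n IH K /ltnSE Kn Kcl.
have [|/hasPn K0] := boolP (has (fun t => K t != 0%VS) ts); last first.
  exists [::]; split=> // s /K0; rewrite negbK => /eqP ->.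
  by rewrite /basis_of span_nil eqxx nil_free.
move=> /ex_min_in[b [bts Kb bmin]].
have Kb0 s : s \in ts -> s < b -> K s = 0%VS.
  by move=> sts sb; apply/eqP; apply: contraTT sb => /(bmin s sts); rewrite leNgt.
pose x := vpick (K b); have x0 : x != 0 by rewrite vpick0.
have xK : x \in K b by exact: memv_pick.
have /ex_max_in[e [ets /andP[be xe0] emax]] :
    has (fun t => (b <= t) && (ptrans M b t x != 0)) ts.
  by apply/hasP; exists b; rewrite // lexx ptrans_id.
have xcl s : s \in ts -> b <= s -> ptrans M b s x \in K s.
  by move=> sts bs; apply: (subvP (Kcl b s bts sts bs)); exact: memv_img.
(* [e] is the last level at which [x] survives; its death is the next level of [ts], or infinity. *)
have [d dts dP] : exists2 d, d \in +oo%E :: [seq t%:E | t <- ts] &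
    (forall t, t \in ts -> (t%:E < d)%E = (t <= e)).
  have [/ex_min_in[d [dts ed dmin]]|/hasPn ne] := boolP (has (fun t => e < t) ts).
    exists d%:E; first by rewrite inE map_f ?orbT.
    move=> t tts; rewrite lte_fin; apply/idP/idP => [td|te]; last exact: le_lt_trans te ed.
    by rewrite leNgt; apply: contraTN td => /(dmin t tts); rewrite leNgt.
  exists +oo%E; first by rewrite inE.
  by move=> t tts; rewrite ltry leNgt ne.
(* A complement of the line of [x] is chosen once, at the last level [e], and pulled back to the
   earlier levels; this makes it stable under the transition maps. *)
pose J := (K e :\: <[ptrans M b e x]>)%VS.
pose K' s := if (b <= s) && (s <= e) then (K s :&: (ptrans M s e @^-1: J))%VS
             else K s.
have K'K s : (K' s <= K s)%VS by rewrite /K'; case: ifP; rewrite ?capvSl.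
have xJ : ptrans M b e x \notin J.
  apply: contra xe0 => xJ; rewrite -memv0 -(capv_diff (K e) <[ptrans M b e x]>%VS).
  by rewrite memv_cap xJ memv_line.
have KE s : s \in ts -> b <= s <= e -> K s = (<[ptrans M b s x]> + K' s)%VS.
  move=> sts /[dup] bse /andP[bs se]; apply/eqP; rewrite eqEsubv.
  rewrite subv_add K'K -memvE xcl // !andbT; apply/subvP => y yK.
  have : ptrans M s e y \in K e.
    by apply: (subvP (Kcl s e sts ets se)); exact: memv_img.
  rewrite -(addv_diff_cap (K e) <[ptrans M b e x]>%VS) addvC.
  move=> /memv_addP[z /memv_capP[_ /vlineP[k ->]]] [j jJ yE].
  have -> : y = k *: ptrans M b s x + (y - k *: ptrans M b s x).
    by rewrite addrC subrK.
  rewrite memv_add ?memvZ ?memv_line // /K' bse memv_cap memvB ?memvZ ?xcl //=.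
  rewrite -memv_preim linearB linearZ /= ptrans_trans // yE addrC addKr.
  exact: jJ.
have xK' s : b <= s <= e -> ptrans M b s x \notin K' s.
  move=> /[dup] bse /andP[bs se]; rewrite /K' bse memv_cap negb_and.
  by rewrite -memv_preim ptrans_trans // xJ orbT.
have [||X [Xts XB]] := IH K'.
- apply: leq_trans Kn; rewrite !(big_rem b bts) /= -addSn leq_add //.
    rewrite ltn_neqAle dimvS // andbT; apply: contra (xK' b _); rewrite ?lexx //.
    by rewrite (dimv_leqif_sup (K'K b)) => /subvP; apply; rewrite ptrans_id.
  by apply: leq_sum => s _; exact: dimvS.
- move=> s t sts tts st; apply/subvP => _ /memv_imgP[y yK' ->].
  have yK := subvP (K'K s) _ yK'.
  have yKt : ptrans M s t y \in K t.
    by apply: (subvP (Kcl s t sts tts st)); exact: memv_img.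
  rewrite /K'; case: ifP => // /andP[bt te]; rewrite memv_cap yKt /=.
  have [sb|bs] := ltP s b.
    by move: yK; rewrite (Kb0 s) // memv0 => /eqP ->; rewrite linear0 mem0v.
  move: yK'; rewrite /K' bs (le_trans st te) memv_cap -!memv_preim => /andP[_].
  by rewrite ptrans_trans.
exists (existT _ b (x, d) :: X); split=> [|s sts].
  rewrite /= Xts andbT /bar_on /= bts dts dP // be /=; apply/allP => t tts.
  apply/implyP; rewrite leNgt dP // -ltNge => et; rewrite /bar_vec /=.
  apply/negPn/negP => xt; move: (emax t tts).
  by rewrite xt (le_trans be (ltW et)) leNgt et => /(_ isT).
rewrite /frame /=.
have -> : interval_pred (bar_pt (existT _ b (x, d))) s = (b <= s <= e).
  by rewrite /interval_pred /= dP.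
have := XB s sts; case: ifP => [bse XBs|nbse].
  by apply: (basis_of_cons (KE s sts bse)); [exact: xK'|].
by rewrite /K' nbse.
Qed.

(** The frame at the last level [e <= s] is carried to [s] by an isomorphism; below all levels the
    module is zero. *)
Lemma full_frame (ts : seq R) :
  (forall s, (forall t, t \in ts -> s < t) -> \dim {: pobj M s} = 0%N) ->
  (forall s t (st : s <= t), (forall u, u \in ts -> ~~ (s < u <= t)) ->
    lker (pmap M st) = 0%VS /\ limg (pmap M st) = fullv) ->
  exists X : seq bar,
    [/\ all (bar_on ts) X, forall s, basis_of fullv (frame X s) &
     forall x s, x \in X -> ((tagged x).2 <= s%:E)%E -> bar_vec s x = 0].
Proof.
move=> M0 Miso; have [|X [Xts XB]] := @subfamily_frame ts (fun s => fullv).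
  by move=> s t _ _ _; exact: subvf.
exists X; split=> // [s|x s xX].
  have [/ex_max_in[e [ets es emax]]|/hasPn ne] := boolP (has (fun t => t <= s) ts).
    have noc u : u \in ts -> ~~ (e < u <= s).
      by move=> uts; apply/negP => /andP[eu /(emax u uts)]; rewrite leNgt eu.
    have [k0 im] := Miso e s es noc.
    rewrite -im; have -> : frame X s = [seq pmap M es v | v <- frame X e].
      rewrite /frame -map_comp.
      have -> : [seq x <- X | interval_pred (bar_pt x) s] =
                [seq x <- X | interval_pred (bar_pt x) e].
        apply: eq_in_filter => x /(allP Xts)/and4P[bts dts _ _].
        rewrite /interval_pred /=; congr (_ && _).
          by apply/idP/idP => [/(emax _ bts)//|/le_trans]; apply.
        move: dts; rewrite inE => /predU1P[->|/mapP[t tts ->]]; first by rewrite !ltry.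
        rewrite !lte_fin; apply/idP/idP => [|et]; first exact: le_lt_trans.
        by rewrite ltNge; apply/negP => ts'; move: (noc t tts); rewrite et ts'.
      apply/eq_in_map => x; rewrite mem_filter => /andP[/andP[be _] _].
      by rewrite /= /bar_vec -ptransE ptrans_trans.
    by apply: limg_basis_of; [rewrite k0 capv0|exact: XB].
  have -> : frame X s = [::].
    rewrite /frame; suff /eq_in_filter-> : {in X, forall x,
        interval_pred (bar_pt x) s = xpred0 x} by rewrite filter_pred0.
    move=> x /(allP Xts)/and4P[bts _ _ _].
    by rewrite /interval_pred (negPf (ne _ bts)).
  have -> : fullv = 0%VS :> {vspace pobj M s}.
    by apply/eqP; rewrite -dimv_eq0 M0 // => t /ne; rewrite ltNge.
  exact: nil_basis.
move=> ds; have /and4P[bts dts bd /allP dth] := allP Xts _ xX.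
move: dts ds bd dth; rewrite inE => /predU1P[->|/mapP[t tts ->]].
  by rewrite leye_eq.
rewrite lee_fin lte_fin => ts' bt /(_ t tts); rewrite lexx /= => /eqP v0.
by rewrite /bar_vec -(ptrans_trans _ (ltW bt) ts') [ptrans M _ t _]v0 linear0.
Qed.

End IntervalDecomposition.

Section Morphisms.
Context d (T : porderType d) (F : fieldType).
Implicit Types M N : pmodule T F.

(** Morphisms out of a direct sum are easy to build, whereas the isomorphism wanted goes into one;
    pointwise inverses are again natural. *)
Lemma pisomorphic_inverse M N (f : pmorphism N M) :
  (forall u, lker (pmor f u) == 0%VS) -> (forall u, limg (pmor f u) = fullv) ->
  pisomorphic M N.
Proof.
move=> f0 f1.
have fV u : cancel (pmor f u)^-1%VF (pmor f u).
  by move=> y; rewrite limg_lfunVK // f1 memvf.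
have nat u v (uv : (u <= v)%O) :
    (pmap N uv \o (pmor f u)^-1)%VF = ((pmor f v)^-1 \o pmap M uv)%VF.
  apply/lfunP => y; rewrite !comp_lfunE -{2}(fV u y).
  have /lfunP/(_ ((pmor f u)^-1%VF y)) := pmor_natural f uv.
  by rewrite !comp_lfunE => ->; rewrite lker0_lfunK.
exists (PMorphism nat) => u /=; exists (pmor f u) => y; first exact: fV.
by rewrite lker0_lfunK.
Qed.

Lemma pmorphism_copair M N1 N2 (f : pmorphism N1 M) (g : pmorphism N2 M) :
  exists h : pmorphism (pdsum2 N1 N2) M,
    forall u, limg (pmor h u) = (limg (pmor f u) + limg (pmor g u))%VS.
Proof.
pose c u (p : (pobj N1 u * pobj N2 u)%type) := pmor f u p.1 + pmor g u p.2.
have clin u : linear (@c u).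
  by move=> a p q; rewrite /c /= !linearP /= scalerDr addrACA.
pose cl u : {linear _ -> _} := HB.pack (@c u) (GRing.isLinear.Build F _ _ _ _ (clin u)).
pose h u : 'Hom(pobj (pdsum2 N1 N2) u, pobj M u) := linfun (cl u).
have nat u v (uv : (u <= v)%O) :
    (pmap M uv \o h u)%VF = (h v \o pmap (pdsum2 N1 N2) uv)%VF.
  apply/lfunP => -[a b]; rewrite !comp_lfunE /h !lfunE /= ?lfunE /= /c /sum_fun /=.
  have /lfunP/(_ a) := pmor_natural f uv; have /lfunP/(_ b) := pmor_natural g uv.
  by rewrite !comp_lfunE linearD /= => -> ->.
exists (PMorphism nat) => u /=; apply/vspaceP => y; apply/idP/idP.
  move=> /memv_imgP[[a b] _ ->]; rewrite /h lfunE /= /c /=.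
  by rewrite memv_add ?memv_img ?memvf.
move=> /memv_addP[_ /memv_imgP[a _ ->] [_ /memv_imgP[b _ ->] ->]].
have -> : pmor f u a + pmor g u b = h u (a, b) by rewrite /h lfunE.
by rewrite memv_img ?memvf.
Qed.

(** Summing the entries reads the scalar off a row of length 0 or 1. Arbitrary booleans in place of
    [S u] and [S v] allow case analysis despite the dependent row types. *)
Lemma sum_row_pid_mx1 (V W : vectType F) (g : 'Hom(V, W)) (y : V) (z : W)
    (a b : bool) (r : 'rV[F]_a) :
  (a -> g y = if b then z else 0) ->
  (\sum_j r 0 j) *: g y =
    (\sum_j (r *m (pid_mx 1 : 'M[F]_(a, b)) : 'rV[F]_b) 0 j) *: z.
Proof.
case: a r => r => [/(_ isT)|_]; last first.
  by rewrite big_ord0 scale0r (thinmx0 r) mul0mx big1 ?scale0r // => j; rewrite mxE.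
case: b => ->; last by rewrite big_ord0 scale0r scaler0.
by rewrite pid_mx_1 mulmx1.
Qed.

Lemma pmorphism_indicator M (S : pred T) (cS : convex_pred S)
    (x : forall u, pobj M u) :
  (forall u v (uv : (u <= v)%O), S u -> pmap M uv (x u) = if S v then x v else 0) ->
  exists f : pmorphism (pindicator F cS) M,
    forall u, limg (pmor f u) = if S u then <[x u]>%VS else 0%VS.
Proof.
move=> xS.
pose c u (r : 'rV[F]_(S u)) : pobj M u := (\sum_j r 0 j) *: x u.
have cP u r : @c u r \in (if S u then <[x u]> else 0)%VS.
  rewrite /c; case: (S u) r => r; first by rewrite memvZ ?memv_line.
  by rewrite big_ord0 scale0r mem0v.
have cQ u y : y \in (if S u then <[x u]> else 0)%VS -> exists r, y = @c u r.
  rewrite /c; case: (S u) => [/vlineP[k ->]|].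
    by exists (const_mx k); rewrite big_ord1 mxE.
  by rewrite memv0 => /eqP ->; exists 0; rewrite big_ord0 scale0r.
have clin u : linear (@c u).
  move=> a p q; rewrite /c scalerA -scalerDl mulr_sumr -big_split /=.
  by congr (_ *: _); apply: eq_bigr => j _; rewrite !mxE.
pose cl u : {linear _ -> _} := HB.pack (@c u) (GRing.isLinear.Build F _ _ _ _ (clin u)).
pose h u : 'Hom(pobj (pindicator F cS) u, pobj M u) := linfun (cl u).
have nat u v (uv : (u <= v)%O) :
    (pmap M uv \o h u)%VF = (h v \o pmap (pindicator F cS) uv)%VF.
  apply/lfunP => r; rewrite !comp_lfunE /h !lfunE /= ?lfunE /= /c linearZ /=.
  exact: sum_row_pid_mx1 (xS u v uv).
exists (PMorphism nat) => u /=; apply/vspaceP => y; rewrite /h.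
apply/idP/idP.
  by move=> /memv_imgP[r _ ->]; rewrite lfunE; exact: cP.
by move=> /cQ[r ->]; apply/memv_imgP; exists r; rewrite ?memvf // lfunE.
Qed.

End Morphisms.

Section FrameIsomorphism.
Context (R : realType) (F : fieldType) (M : pmodule R F).

Lemma dim_pdsum_interval (X : seq (bar M)) s :
  \dim {: pobj (pdsum [seq pinterval F p | p <- [seq bar_pt x | x <- X]]) s} =
  size (frame X s).
Proof.
rewrite size_map size_filter -[X in count _ X]map_id.
elim: X => [|x X IH] /=; rewrite dimvf /dim /=.
  by rewrite mul1n.
by rewrite /dim /= mul1n /= -IH dimvf.
Qed.

Lemma pmorphism_frame (X : seq (bar M)) :
  (forall x s, x \in X -> ((tagged x).2 <= s%:E)%E -> bar_vec s x = 0) ->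
  exists f : pmorphism (pdsum [seq pinterval F p | p <- [seq bar_pt x | x <- X]]) M,
    forall s, limg (pmor f s) = <<frame X s>>%VS.
Proof.
elim: X => [_|x X IH dth] /=.
  have [|f fE] := @pmorphism_indicator _ _ _ M xpred0 (fun _ _ _ _ _ _ h => h) (fun=> 0).
    by [].
  by exists f => s; rewrite fE span_nil.
have [|g gE] := IH; first by move=> y s yX; apply: dth; rewrite inE yX orbT.
have [|f fE] := @pmorphism_indicator _ _ _ M _ (interval_convex (p := bar_pt x))
    (fun s => bar_vec s x).
  move=> u v uv /andP[bu ud]; rewrite /bar_vec -ptransE ptrans_trans //.
  case: ifPn => //; rewrite /interval_pred (le_trans bu uv) /= -leNgt => dv.
  by rewrite [LHS]dth ?mem_head.
have [h hE] := pmorphism_copair f g.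
exists h => s; rewrite hE fE gE /frame /=.
by case: ifP => _; rewrite ?span_cons ?add0v.
Qed.

(** The frames span, so the map from the sum of intervals is onto; they are bases, so dimensions
    agree and it is injective. *)
Lemma ex_is_dgm (ts : seq R) :
  (forall s, (forall t, t \in ts -> s < t) -> \dim {: pobj M s} = 0%N) ->
  (forall s t (st : s <= t), (forall u, u \in ts -> ~~ (s < u <= t)) ->
    lker (pmap M st) = 0%VS /\ limg (pmap M st) = fullv) ->
  exists D : seq (R * \bar R), is_dgm M D /\
    forall p, p \in D -> p.1 \in ts /\ p.2 \in +oo%E :: [seq t%:E | t <- ts].
Proof.
move=> M0 Miso; have [X [Xts XB dth]] := full_frame M0 Miso.
have [f fE] := pmorphism_frame dth.
exists [seq bar_pt x | x <- X]; split=> [|_ /mapP[x xX ->]]; last first.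
  by have /and4P[bts dts _ _] := allP Xts _ xX.
split=> [_ /mapP[x xX ->]|].
  by have /and4P[] := allP Xts _ xX.
have fim s : limg (pmor f s) = fullv by rewrite fE; exact/eqP/(andP (XB s)).1.
apply: (pisomorphic_inverse (f := f)) => // s.
rewrite -dimv_eq0 -(eqn_add2r (\dim (limg (pmor f s)))) add0n -{1}[lker _]capfv.
rewrite limg_ker_dim fim dim_pdsum_interval.
have /andP[/eqP <- /eqP ->] := XB s.
by rewrite eqxx.
Qed.

End FrameIsomorphism.

(** * The bottleneck distance of lists *)

Section BottleneckTheory.
Context (R : realType).
Local Open Scope ereal_scope.
Implicit Types p q : R * \bar R.

Section Tuples.
Context (n m : nat).
Implicit Types (A : n.-tuple (R * \bar R)%type) (B : m.-tuple (R * \bar R)%type).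

(** With the lengths as parameters, mapping over a list leaves the type of matchings unchanged. *)
Definition tuple_cost A B (s : {ffun 'I_n -> option 'I_m}) : \bar R :=
  maxe
    (\big[maxe/0]_(i < n)
       match s i with
       | Some j => pt_dist (tnth A i) (tnth B j)
       | None => half_pers (tnth A i)
       end)
    (\big[maxe/0]_(j < m | [forall i, s i != Some j]) half_pers (tnth B j)).

Lemma tuple_cost_leP A B s e : tuple_cost A B s <= e <->
  [/\ 0 <= e,
      forall i, match s i with
       | Some j => pt_dist (tnth A i) (tnth B j)
       | None => half_pers (tnth A i)
       end <= e &
      forall j, (forall i, s i != Some j) -> half_pers (tnth B j) <= e].
Proof.
rewrite /tuple_cost ge_max; split.
  move=> /andP[/bigmax_leP[e0 h1] /bigmax_leP[_ h2]]; split=> // [i|j sj].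
    exact: h1.
  by apply: h2; apply/forallP.
move=> [e0 h1 h2]; apply/andP; split; apply/bigmax_leP; split=> //.
by move=> j /forallP sj; exact: h2.
Qed.

Lemma is_matchingP (s : {ffun 'I_n -> option 'I_m}) :
  reflect (forall i i' j, s i = Some j -> s i' = Some j -> i = i') (is_matching s).
Proof.
apply: (iffP idP) => [/forallP sm i i' j si si'|sm].
  by have /forallP/(_ i') := sm i; rewrite si si' eqxx /= => /eqP.
apply/forallP => i; apply/forallP => i'; apply/implyP.
by case E : (s i) => [j|] //= /eqP /esym /(sm _ _ _ E) ->.
Qed.

End Tuples.

Lemma bottleneck_tuple n m (A : n.-tuple (R * \bar R)%type)
    (B : m.-tuple (R * \bar R)%type) :
  bottleneck A B = \big[mine/+oo]_(s | is_matching s) tuple_cost A B s.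
Proof.
case: A => A As; case: B => B Bs; have En := esym (eqP As); have Em := esym (eqP Bs).
subst n m; rewrite (_ : Tuple As = in_tuple A); last exact: val_inj.
by rewrite (_ : Tuple Bs = in_tuple B); last exact: val_inj.
Qed.

(** The distance is a min-max expression in elementary costs, so a relation compatible with these
    operations passes to it. The uses are scaling, and being one and the same term under two
    valuations. *)
Lemma bottleneck_rel (rel : \bar R -> \bar R -> Prop) (I J : eqType)
    (s : seq I) (t : seq J) (f f' : I -> R * \bar R) (g g' : J -> R * \bar R) :
  rel 0 0 -> rel +oo +oo ->
  (forall x x' y y', rel x x' -> rel y y' -> rel (maxe x y) (maxe x' y')) ->
  (forall x x' y y', rel x x' -> rel y y' -> rel (mine x y) (mine x' y')) ->
  (forall i j, i \in s -> j \in t ->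
    rel (pt_dist (f i) (g j)) (pt_dist (f' i) (g' j))) ->
  (forall i, i \in s -> rel (half_pers (f i)) (half_pers (f' i))) ->
  (forall j, j \in t -> rel (half_pers (g j)) (half_pers (g' j))) ->
  rel (bottleneck [seq f i | i <- s] [seq g j | j <- t])
      (bottleneck [seq f' i | i <- s] [seq g' j | j <- t]).
Proof.
move=> r0 roo rmax rmin rd rs rt.
rewrite (bottleneck_tuple (map_tuple f (in_tuple s)) (map_tuple g (in_tuple t))).
rewrite (bottleneck_tuple (map_tuple f' (in_tuple s)) (map_tuple g' (in_tuple t))).
apply: (big_ind2 rel roo) => [x x' y y'|c _]; [exact: rmin|apply: (rmax _ _ _ _)].
  apply: (big_ind2 rel r0) => [x x' y y'|i _]; first exact: rmax.
   case: (c i) => [j|]; rewrite !tnth_map.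
    by apply: rd; exact: mem_tnth.
  by apply: rs; exact: mem_tnth.
apply: (big_ind2 rel r0) => [x x' y y'|j _]; first exact: rmax.
rewrite !tnth_map.
by apply: rt; exact: mem_tnth.
Qed.

Definition diagonal p : bool := p.2 == p.1%:E.

Lemma half_pers_diagonal p : diagonal p -> half_pers p = 0.
Proof. by case: p => b d /eqP /= ->; rewrite /half_pers /= subee // mul0e. Qed.

Lemma coord_dist_fin (x y : R) : coord_dist x%:E y%:E = `|x - y|%:E.
Proof.
rewrite /coord_dist; case: eqP => [[->]|_]; first by rewrite subrr normr0.
by rewrite -EFinB abse_EFin.
Qed.

Lemma pt_distC p q : pt_dist p q = pt_dist q p.
Proof.
have C (x y : \bar R) : coord_dist x y = coord_dist y x.
  move: x y => [x| |] [y| |] //; first by rewrite !coord_dist_fin distrC.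
by rewrite /pt_dist C [in LHS](C p.2).
Qed.

(** Half the persistence is the sup-norm distance to the diagonal, so a diagonal partner is no
    cheaper than none. *)
Lemma half_pers_le_diagonal p q : diagonal q -> half_pers p <= pt_dist p q.
Proof.
case: p q => b d [c _] /eqP /= ->; rewrite /half_pers /pt_dist /=.
case: d => [d| |] /=.
- rewrite !coord_dist_fin -EFinB -EFinM -EFin_max lee_fin le_max.
  have := ler_norm (c - b)%R; rewrite distrC; have := ler_norm (d - c)%R.
  by case: (lerP ((d - b) / 2)%R `|b - c|%R) => //=; lra.
- by rewrite /coord_dist /= le_max leey orbT.
- by rewrite addNye mulNyr gtr0_sg ?invr_gt0// mul1e leNye.
Qed.

Lemma perm_filter_index (T : eqType) (p : pred T) (A A' : seq T) :
  perm_eq A' [seq x <- A | p x] ->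
  exists phi : 'I_(size A') -> 'I_(size A),
    [/\ injective phi,
        forall i, tnth (in_tuple A') i = tnth (in_tuple A) (phi i) &
        forall k, (forall i, phi i <> k) -> ~~ p (tnth (in_tuple A) k)].
Proof.
case: A' => [|x0 A'0] AA'.
  have nA : ~~ has p A by rewrite has_filter negbK; rewrite perm_sym in AA'; exact/eqP/perm_nilP.
  exists (fun i : 'I_0 => match i with Ordinal _ h => False_rect _ (notF h) end).
  split=> [[]|[]|k _] //.
  by apply/negP => pk; case/hasP: nA; exists (tnth (in_tuple A) k); rewrite ?mem_tnth.
set B := x0 :: A'0 in AA' *.
pose idx := [seq k <- iota 0 (size A) | p (nth x0 A k)].
have FE : [seq x <- A | p x] = [seq nth x0 A k | k <- idx].
  by rewrite -{1}(mkseq_nth x0 A) /mkseq filter_map.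
have [Is Isp BE] := perm_iotaP x0 AA'.
pose Js := [seq nth 0%N idx i | i <- Is].
have szI : size idx = size [seq x <- A | p x] by rewrite FE size_map.
have Jidx : perm_eq Js idx.
  by apply/(perm_iotaP 0%N); exists Is; rewrite // szI.
have BJ : B = [seq nth x0 A k | k <- Js].
  rewrite BE -map_comp; apply/eq_in_map => i; rewrite (perm_mem Isp) mem_iota /= add0n.
  by move=> il; rewrite FE (nth_map 0%N) // szI.
have szJ : size Js = size B by rewrite BJ size_map.
have JA k : k \in Js = (k < size A)%N && p (nth x0 A k).
  by rewrite (perm_mem Jidx) mem_filter mem_iota /= add0n andbC.
have ltJ (i : 'I_(size B)) : (nth 0%N Js i < size A)%N.
  have : nth 0%N Js i \in Js by rewrite mem_nth ?szJ.
  by rewrite JA => /andP[].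
exists (fun i => Ordinal (ltJ i)); split.
- move=> i j /(congr1 val) /= /eqP; rewrite nth_uniq ?szJ // => [/eqP/val_inj //|].
  by rewrite (perm_uniq Jidx) filter_uniq ?iota_uniq.
- move=> i; rewrite !(tnth_nth x0) /= {1}BJ (nth_map 0%N) ?szJ //.
- move=> k nk; apply/negP; rewrite (tnth_nth x0) /= => pk.
  have kJ : (k : nat) \in Js by rewrite JA ltn_ord.
  have ki : (index (k : nat) Js < size B)%N by rewrite -szJ index_mem.
  by apply: (nk (Ordinal ki)); apply: val_inj; rewrite /= nth_index.
Qed.

(** Diagonal points cost nothing unmatched and gain nothing as partners. *)
Lemma bottleneck_perm_filter (A A' B B' : seq (R * \bar R)) :
  perm_eq A' [seq p <- A | ~~ diagonal p] -> perm_eq B' [seq p <- B | ~~ diagonal p] ->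
  bottleneck A B = bottleneck A' B'.
Proof.
move=> /perm_filter_index[phi [phi_inj phiE phiN]].
move=> /perm_filter_index[psi [psi_inj psiE psiN]].
rewrite (bottleneck_tuple (in_tuple A) (in_tuple B)).
rewrite (bottleneck_tuple (in_tuple A') (in_tuple B')).
apply/eqP; rewrite eq_le; apply/andP; split; apply/bigmin_geP; split; rewrite ?leey //.
- move=> s' /is_matchingP ms'.
  have /tuple_cost_leP[e0 c1 c2] := lexx (tuple_cost (in_tuple A') (in_tuple B') s').
  set e := tuple_cost _ _ _ in e0 c1 c2 *.
  (* Extend [s'] by leaving the diagonal points unmatched. *)
  pose s := [ffun k => if [pick i | phi i == k] is Some i then omap psi (s' i) else None].
  have sphi i : s (phi i) = omap psi (s' i).
    rewrite ffunE; case: pickP => [i' /eqP/phi_inj -> //|/(_ i)].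
    by rewrite eqxx.
  have sN k : (forall i, phi i <> k) -> s k = None.
    by move=> nk; rewrite ffunE; case: pickP => // i /eqP /nk.
  have imP k : (exists i, phi i = k) \/ (forall i, phi i <> k).
    by have [|/forallNP] := pselect (exists i, phi i = k); [left|right].
  apply: (@bigmin_inf _ _ _ _ s).
    apply/is_matchingP => k k' j.
    have [[i <-]|/sN -> //] := imP k; have [[i' <-]|/sN -> //] := imP k'.
    rewrite !sphi; case E : (s' i) => [l|] //= [<-]; case E' : (s' i') => [l'|] //=.
    by move=> [] /psi_inj ll'; rewrite (ms' i i' l) // E' ll'.
  apply/tuple_cost_leP; split=> // [k|l sl].
    have [[i <-]|nk] := imP k.
      rewrite sphi; have := c1 i; case: (s' i) => [j|] /=.
        by rewrite phiE psiE.
      by rewrite phiE.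
    by rewrite sN // half_pers_diagonal // -[diagonal _]negbK phiN.
  have [[j jl]|nl] := pselect (exists j, psi j = l).
    rewrite -jl -psiE; apply: c2 => i; have := sl (phi i); rewrite sphi -jl.
    by apply: contra => /eqP ->.
  rewrite half_pers_diagonal // -[diagonal _]negbK psiN // => j jl.
  by apply: nl; exists j.
- move=> s /is_matchingP ms.
  have /tuple_cost_leP[e0 c1 c2] := lexx (tuple_cost (in_tuple A) (in_tuple B) s).
  set e := tuple_cost _ _ _ in e0 c1 c2 *.
  (* Restrict [s], dropping the pairs that contain a diagonal point. *)
  pose s' := [ffun i => if s (phi i) is Some l then [pick j | psi j == l] else None].
  have s'E i j : s' i = Some j -> s (phi i) = Some (psi j).
    by rewrite ffunE; case: (s (phi i)) => // l; case: pickP => // j' /eqP <- [->].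
  apply: (@bigmin_inf _ _ _ _ s').
    by apply/is_matchingP => i i' j /s'E si /s'E si'; exact/phi_inj/(ms _ _ _ si si').
  apply/tuple_cost_leP; split=> // [i|j sj].
    case E : (s' i) => [j|].
      by have := c1 (phi i); rewrite (s'E _ _ E) phiE psiE.
    move: E; have := c1 (phi i); rewrite ffunE phiE; case: (s (phi i)) => // l cl.
    case: pickP => // nl _; apply: le_trans cl; apply: half_pers_le_diagonal.
    by rewrite -[diagonal _]negbK psiN // => j /eqP; rewrite nl.
  case: (pselect (exists k, s k = Some (psi j))) => [[k sk]|nk]; last first.
    rewrite psiE; apply: c2 => k; apply/eqP => sk; apply: nk; by exists k.
  have := c1 k; rewrite sk pt_distC -psiE; apply: le_trans.
  apply: half_pers_le_diagonal; rewrite -[diagonal _]negbK phiN // => i ik.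
  have /eqP := sj i; apply; rewrite ffunE ik sk.
  by case: pickP => [j' /eqP/psi_inj -> //|/(_ j)]; rewrite eqxx.
Qed.

End BottleneckTheory.

(** * Diagrams determined by rank functions *)

Section RankDiagrams.
Context (R : realType).
Implicit Types (D : seq (R * \bar R)) (E : seq R).

Lemma ex_below E (x : R) : exists2 y, y < x & forall e, e \in E -> e < x -> e <= y.
Proof.
have [/ex_max_in[y [_ yx ymax]]|/hasPn nE] := boolP (has (fun e => e < x) E).
  by exists y.
exists (x - 1) => [|e /nE]; first by rewrite ltrBlDr ltrDl.
by move=> /negPf ->.
Qed.

Lemma ex_upper E : exists y, forall e, e \in E -> e <= y.
Proof.
have [/ex_max_in[y [_ _ ymax]]|/hasPn nE] := boolP (has predT E).
  by exists y => e eE; exact: ymax.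
by exists 0 => e /nE.
Qed.

Lemma ex_lower E : exists y, forall e, e \in E -> y < e.
Proof.
have [/ex_min_in[y [_ _ ymin]]|/hasPn nE] := boolP (has predT E).
  by exists (y - 1) => e /ymin/(_ isT); apply: lt_le_trans; rewrite ltrBlDr ltrDl.
by exists 0 => e /nE.
Qed.

Lemma count_add (T : eqType) (a b c : pred T) (s : seq T) :
  {in s, forall x, a x = b x + c x :> nat}%N ->
  (count a s = count b s + count c s)%N.
Proof.
elim: s => //= x s IH abc; rewrite IH => [|y ys].
  by rewrite (abc x (mem_head _ _)) addnACA.
by rewrite abc // inE ys orbT.
Qed.

Definition proper_dgm D := forall p, p \in D -> (p.1%:E < p.2)%E.

Definition rank_count D (s t : R) : nat :=
  count (fun p => (p.1 <= s) && (t%:E < p.2)%E) D.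

(** Inclusion-exclusion: the multiplicity of (b, d) is an alternating sum of ranks at [b] and just
    below it, and at [d] and just below it. *)
Lemma rank_count_perm D D' : proper_dgm D -> proper_dgm D' ->
  (forall s t, s <= t -> rank_count D s t = rank_count D' s t) -> perm_eq D D'.
Proof.
move=> pD pD' cDD'; apply/allP => -[b d]; rewrite /= mem_cat => bdDD'.
have bd : (b%:E < d)%E by case/orP: bdDD' => [/pD|/pD'].
pose Z := D ++ D'; pose E := b :: [seq p.1 | p <- Z] ++ [seq fine p.2 | p <- Z].
have E1 p : p \in Z -> p.1 \in E by move=> pZ; rewrite inE mem_cat map_f ?orbT.
have E2 p (e : R) : p \in Z -> p.2 = e%:E -> e \in E.
  by move=> pZ pe; rewrite inE mem_cat [X in _ || (_ || X)](_ : _ = true) ?orbT //;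
    apply/mapP; exists p; rewrite // pe.
have [b' b'b b'max] := ex_below E b.
(* For infinite [d], a level above all finite endpoints serves as just below [d]. The bound
   [b <= d'] keeps to pairs on which the ranks are known to agree. *)
have [d' bd' d'P] : exists2 d', b <= d' &
    forall p, p \in Z -> (d'%:E < p.2)%E = (d <= p.2)%E.
  case: d bd {bdDD'} => [d| |] // bd.
    have [y yd ymax] := ex_below E d.
    exists y; first by apply: ymax; rewrite ?mem_head.
    move=> p pZ; case pe : p.2 => [e| |] //; last by rewrite !leey ltry.
    rewrite lte_fin lee_fin; apply/idP/idP => [|/(lt_le_trans yd)//].
    move=> ye; rewrite leNgt; apply/negP => ed.
    by move: ye; rewrite ltNge (ymax e) //; exact: E2 pe.
  have [y yE] := ex_upper E; exists y; first by rewrite yE ?mem_head.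
  move=> p pZ; case pe : p.2 => [e| |] //; last by rewrite ltry.
  by rewrite lte_fin leye_eq ltNge yE //; exact: E2 pe.
have fE D1 : {subset D1 <= Z} -> forall s, s <= b ->
    (count (fun p => (p.1 <= s)%R && (p.2 == d)) D1 +
     (if d is d0%:E then rank_count D1 s d0 else 0) = rank_count D1 s d')%N.
  move=> D1Z s sb; case: d bd d'P {bdDD'} => [d| |] // bd d'P.
    symmetry; apply: count_add => p ppD; rewrite (d'P p (D1Z _ ppD)).
    rewrite [(d%:E <= _)%E]le_eqVlt [d%:E == _]eq_sym; case: (p.1 <= s) => //=.
    by case: (eqVneq p.2 d%:E) => [->|_] //=; rewrite ltxx.
  rewrite addn0; apply: eq_in_count => p ppD; rewrite (d'P p (D1Z _ ppD)).
  by rewrite leye_eq.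
have mE D1 : {subset D1 <= Z} ->
    (count (fun p => (p.1 <= b)%R && (p.2 == d)) D1 = count_mem (b, d) D1 +
     count (fun p => (p.1 <= b')%R && (p.2 == d)) D1)%N.
  move=> D1Z; apply: count_add => -[p1 p2] pD1 /=.
  have := b'max p1 (E1 _ (D1Z _ pD1)); rewrite xpair_eqE.
  case: (ltgtP p1 b) => [pb /(_ isT) -> //|bp _|-> _] /=.
    by rewrite leNgt (lt_trans b'b bp).
  by rewrite leNgt b'b addn0.
have DZ : {subset D <= Z} by move=> p; rewrite mem_cat => ->.
have D'Z : {subset D' <= Z} by move=> p; rewrite mem_cat orbC => ->.
have same s : s <= b -> count (fun p => (p.1 <= s) && (p.2 == d)) D =
    count (fun p => (p.1 <= s) && (p.2 == d)) D'.
  move=> sb; have := fE D DZ s sb; rewrite cDD'; last exact: le_trans bd'.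
  rewrite -(fE D' D'Z s sb); case: (d) bd => [d0| |] // bd0.
    by rewrite cDD' ?(le_trans sb) ?ltW // => /addIn.
  by rewrite !addn0.
by rewrite -(eqn_add2r (count (fun p => (p.1 <= b') && (p.2 == d)) D)) -mE //
  (same _ (ltW b'b)) same // mE.
Qed.

(** * Diagrams with symbolic endpoints *)

Section Symbolic.
Context (X : eqType).
Implicit Types (C : seq X) (rk : seq X -> seq X -> nat) (q : X -> R).
Implicit Types (S : seq (X * option X)).

(** Ranks are read off sublevel sets, so this applies also to a valuation that comes from no line of
    positive slope. *)
Definition is_rank_dgm C rk q D : Prop :=
  proper_dgm D /\
  forall s t, s <= t ->
    rank_count D s t = rk [seq u <- C | q u <= s] [seq u <- C | q u <= t].

Definition value_dgm q S : seq (R * \bar R) :=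
  [seq (q x.1, if x.2 is Some v then (q v)%:E else +oo%E) | x <- S].

Definition endpoints_in C S : Prop :=
  forall x, x \in S -> x.1 \in C /\ forall v, x.2 = Some v -> v \in C.

(** Weak on purpose: values that differ inside a cell may coincide on its boundary. *)
Definition order_preserving C q q' : Prop :=
  forall u v, u \in C -> v \in C -> q u <= q v -> q' u <= q' v.

Lemma ex_symbolic C q D :
  (forall p, p \in D -> p.1 \in [seq q u | u <- C] /\
    p.2 \in +oo%E :: [seq t%:E | t <- [seq q u | u <- C]]) ->
  exists S, D = value_dgm q S /\ endpoints_in C S.
Proof.
elim: D => [_|p D IH pD]; first by exists [::].
have [|S [DS SC]] := IH; first by move=> p' p'D; apply: pD; rewrite inE p'D orbT.
have [/mapP[u uC pu]] := pD p (mem_head _ _).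
rewrite inE => /predU1P[po|/mapP[t /mapP[v vC tv] pt]].
  exists ((u, None) :: S); split; first by rewrite /= -DS -pu -po; case: (p).
  by move=> x; rewrite inE => /predU1P[->|/SC].
exists ((u, Some v) :: S); split; first by rewrite /= -DS -pu -tv -pt; case: (p).
by move=> x; rewrite inE => /predU1P[->|/SC //]; split=> // _ [<-].
Qed.

Lemma ex_threshold C q q' s : order_preserving C q q' ->
  exists s', forall u, u \in C -> (q u <= s') = (q' u <= s).
Proof.
move=> qq'; pose V := [seq q u | u <- C & q' u <= s].
have [/ex_max_in[y [/mapP[u +] yu _ ymax]]|/hasPn nV] := boolP (has predT V).
  rewrite mem_filter => /andP[us uC]; exists (q u) => v vC.
  apply/idP/idP => [vu|vs]; first exact: le_trans (qq' _ _ vC uC vu) us.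
  by rewrite -yu ymax // map_f // mem_filter vs.
have [y yE] := ex_lower [seq q u | u <- C].
exists y => u uC; rewrite leNgt yE ?map_f //; symmetry; apply/negP => us.
have /nV // : q u \in V by rewrite map_f // mem_filter us.
Qed.

(* A diagram transports along a weakening of the order of its endpoints, losing
   only the points that collapse to the diagonal: the sublevel sets of the new
   valuation are among those of the old one. *)
Lemma is_rank_dgm_transport C rk q q' S :
  order_preserving C q q' -> endpoints_in C S ->
  is_rank_dgm C rk q (value_dgm q S) ->
  is_rank_dgm C rk q' [seq p <- value_dgm q' S | ~~ diagonal p].
Proof.
move=> qq' SC [prop cnt]; split.
  move=> p; rewrite mem_filter => /andP[nd /mapP[x xS pE]].
  have [x1C x2C] := SC x xS; move: (prop _ (map_f _ xS)) nd.
  rewrite pE /= /diagonal /=; case: x.2 x2C => [v /(_ v erefl) vC|_ _ _].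
    rewrite !lte_fin eqe => /ltW quv nd.
    by rewrite lt_neqAle eq_sym nd qq'.
  by rewrite ltry.
move=> s t st; have [s1 s1P] := ex_threshold s qq'; have [t1 t1P] := ex_threshold t qq'.
(* The minimum forces the thresholds into the order that [cnt] requires; as [s <= t], it does not
   change the sublevel set. *)
pose s2 := Num.min s1 t1.
have s2P u : u \in C -> (q u <= s2) = (q' u <= s).
  move=> uC; rewrite le_min s1P // t1P //; case: (leP (q' u) s) => //= us.
  exact: le_trans us st.
have -> : [seq u <- C | q' u <= s] = [seq u <- C | q u <= s2].
  by apply: eq_in_filter => u uC; rewrite s2P.
have -> : [seq u <- C | q' u <= t] = [seq u <- C | q u <= t1].
  by apply: eq_in_filter => u uC; rewrite t1P.
rewrite -cnt; last by rewrite /s2 ge_min lexx orbT.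
rewrite /rank_count count_filter /value_dgm !count_map.
apply: eq_in_count => x xS /=; have [x1C x2C] := SC x xS.
rewrite s2P //; case: x.2 x2C => [v /(_ v erefl) vC|_]; rewrite /diagonal /=.
  rewrite !lte_fin !ltNge t1P //; case: (leP (q' x.1) s) => //= xs.
  case: (leP (q' v) t) => //= vt; rewrite eqe gt_eqF //.
  by apply: le_lt_trans xs (le_lt_trans st vt).
by rewrite !ltry !andbT.
Qed.

(** Equal ranks make [DM] a permutation of the transported diagram, which differs from
    [value_dgm q' SM] only by diagonal points; likewise for [DN]. *)
Lemma bottleneck_value_dgm CM CN rkM rkN q q' SM SN DM DN :
  order_preserving CM q q' -> order_preserving CN q q' ->
  endpoints_in CM SM -> endpoints_in CN SN ->
  is_rank_dgm CM rkM q (value_dgm q SM) -> is_rank_dgm CN rkN q (value_dgm q SN) ->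
  is_rank_dgm CM rkM q' DM -> is_rank_dgm CN rkN q' DN ->
  bottleneck DM DN = bottleneck (value_dgm q' SM) (value_dgm q' SN).
Proof.
move=> oM oN eM eN dM dN [pM cM] [pN cN]; symmetry.
have [pM' cM'] := is_rank_dgm_transport oM eM dM.
have [pN' cN'] := is_rank_dgm_transport oN eN dN.
apply: bottleneck_perm_filter; apply: rank_count_perm => // s t st.
  by rewrite cM // cM'.
by rewrite cN // cN'.
Qed.

Lemma bottleneck_affine q q' SM SN (h c : R) : 0 < h ->
  (forall u, q' u = h * q u + c) ->
  bottleneck (value_dgm q' SM) (value_dgm q' SN) =
  (h%:E * bottleneck (value_dgm q SM) (value_dgm q SN))%E.
Proof.
move=> h0 q'E; pose rel (x y : \bar R) := y = (h%:E * x)%E.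
have dE x y : `|q' x - q' y| = h * `|q x - q y|.
  by rewrite !q'E opprD addrACA subrr addr0 -mulrBr normrM gtr0_norm.
have hoo : (h%:E * +oo = +oo :> \bar R)%E by rewrite gt0_muley.
have hp (u : X) (v : option X) :
    half_pers (q' u, if v is Some v then (q' v)%:E else +oo%E) =
    (h%:E * half_pers (q u, if v is Some v then (q v)%:E else +oo%E))%E.
  case: v => [v|]; rewrite /half_pers /=.
    by rewrite !q'E -EFinM; congr EFin; ring.
  by rewrite addye // gt0_mulye ?lte_fin ?invr_gt0 // hoo.
apply: (@bottleneck_rel _ rel); rewrite /rel ?mule0 ?hoo //.
- by move=> x x' y y' -> ->; rewrite maxe_pMr // ltW.
- by move=> x x' y y' -> ->; rewrite mine_pMr // ltW.
- move=> [u u2] [v v2] _ _; rewrite /pt_dist maxe_pMr ?ltW //=.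
  rewrite !coord_dist_fin -EFinM dE; congr maxe.
  case: u2 v2 => [u2|] [v2|] //=; rewrite ?coord_dist_fin ?dE //.
  by rewrite /coord_dist eqxx mule0.
Qed.

(** The possible elementary costs: denominator 1 for a distance of coordinates, 2 for a half
    persistence, [None] for infinity. *)
Definition term_index := option (X * X * nat).

Definition term q (i : term_index) : \bar R :=
  if i is Some (u, v, n) then (`|q u - q v| / n%:R)%:E else +oo%E.

Definition term_in C (i : term_index) : Prop :=
  if i is Some (u, v, n) then [/\ u \in C, v \in C & n \in [:: 1; 2]%N] else True.

Definition term_order_preserving C q q' : Prop :=
  forall i j, term_in C i -> term_in C j ->
    (term q i <= term q j)%E -> (term q' i <= term q' j)%E.

(** Comparisons alone decide which term attains the min-max, so a weakly order-preserving change of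
    valuation keeps a common index. *)
Lemma bottleneck_term CM CN q q' SM SN u0 :
  u0 \in CM ++ CN -> term_order_preserving (CM ++ CN) q q' ->
  order_preserving CM q q' -> order_preserving CN q q' ->
  endpoints_in CM SM -> endpoints_in CN SN ->
  proper_dgm (value_dgm q SM) -> proper_dgm (value_dgm q SN) ->
  exists i, [/\ term_in (CM ++ CN) i,
    bottleneck (value_dgm q SM) (value_dgm q SN) = term q i &
    bottleneck (value_dgm q' SM) (value_dgm q' SN) = term q' i].
Proof.
move=> u0C tqq' oM oN eM eN pM pN.
pose rel (x y : \bar R) := exists i,
  [/\ term_in (CM ++ CN) i, x = term q i & y = term q' i].
have rel_dist u v : u \in CM ++ CN -> v \in CM ++ CN ->
    rel (coord_dist (q u)%:E (q v)%:E) (coord_dist (q' u)%:E (q' v)%:E).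
  move=> uC vC; exists (Some (u, v, 1%N)); split; rewrite /= ?coord_dist_fin ?divr1 //.
(* The cost 0 must be a term too; this is where a critical point has to exist. *)
have rel0 : rel 0%E 0%E.
  by exists (Some (u0, u0, 1%N)); split; rewrite //= subrr normr0 mul0r.
have reloo : rel +oo%E +oo%E by exists None.
have relmax x x' y y' : rel x x' -> rel y y' -> rel (maxe x y) (maxe x' y').
  move=> [i [iC -> ->]] [j [jC -> ->]].
  have [ij|/ltW ji] := leP (term q i) (term q j).
    by exists j; split=> //; apply/max_idPr; exact: tqq'.
  by exists i; split=> //; apply/max_idPl; exact: tqq'.
have relmin x x' y y' : rel x x' -> rel y y' -> rel (mine x y) (mine x' y').
  move=> [i [iC -> ->]] [j [jC -> ->]].
  have [ij|/ltW ji] := leP (term q i) (term q j).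
    by exists i; split=> //; apply/min_idPl; exact: tqq'.
  by exists j; split=> //; apply/min_idPr; exact: tqq'.
have half C S : {subset C <= CM ++ CN} -> order_preserving C q q' ->
    endpoints_in C S -> proper_dgm (value_dgm q S) -> forall x, x \in S ->
    rel (half_pers (q x.1, if x.2 is Some v then (q v)%:E else +oo%E))
        (half_pers (q' x.1, if x.2 is Some v then (q' v)%:E else +oo%E)).
  move=> CC oC eC pC x xS; have [x1C x2C] := eC x xS.
  have := pC _ (map_f _ xS); case: x.2 x2C => [v /(_ v erefl) vC|_] /=; last first.
    by rewrite /half_pers /= !addye // gt0_mulye ?lte_fin ?invr_gt0.
  rewrite lte_fin => /ltW quv; exists (Some (v, x.1, 2%N)).
  split; first by split; rewrite ?CC.
    by rewrite /= ger0_norm ?subr_ge0 // /half_pers /= -EFinB -EFinM.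
  by rewrite /= ger0_norm ?subr_ge0 ?oC // /half_pers /= -EFinB -EFinM.
have subM : {subset CM <= CM ++ CN} by move=> u; rewrite mem_cat => ->.
have subN : {subset CN <= CM ++ CN} by move=> u; rewrite mem_cat orbC => ->.
apply: (@bottleneck_rel _ rel) => //.
- move=> x y xS yS; rewrite /pt_dist /=; have [x1C x2C] := eM x xS.
  have [y1C y2C] := eN y yS; apply: (relmax); first by apply: rel_dist; [exact: subM|exact: subN].
  case: x.2 y.2 x2C y2C => [x2|] [y2|] /=.
  + by move=> /(_ _ erefl) h1 /(_ _ erefl) h2; apply: rel_dist; [exact: subM|exact: subN].
  + by [].
  + by [].
  + by rewrite /coord_dist eqxx.
- exact: half subM oM eM pM.
- exact: half subN oN eN pN.
Qed.

End Symbolic.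
End RankDiagrams.

(** * Cells of lines *)

(** When [p] is added, either [t] stays, or it moves back to the zero of the [p]-th function; the
    others, nonnegative at 0 and at the old [t], are so in between. *)
Lemma first_hit (R : realFieldType) (X : eqType) (l : seq X) (A B : X -> R) :
  {in l, forall p, 0 < A p} ->
  exists t, [/\ 0 <= t <= 1, {in l, forall p, 0 <= (1 - t) * A p + t * B p} &
    t = 1 \/ exists2 p, p \in l & (1 - t) * A p + t * B p = 0].
Proof.
elim: l => [_|p l IH A0]; first by exists 1; split; [lra|by []|left].
have [|t [t01 tB tE]] := IH; first by move=> r rl; apply: A0; rewrite inE rl orbT.
have Ap := A0 p (mem_head _ _).
have [pB|pB] := leP 0 ((1 - t) * A p + t * B p).
  exists t; split=> // [r|]; first by rewrite inE => /predU1P[->|/tB].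
  by case: tE => [->|[r rl rE]]; [left|right; exists r; rewrite // inE rl orbT].
have AB : 0 < A p - B p by nra.
pose s := A p / (A p - B p).
have sE : s * (A p - B p) = A p by rewrite /s divfK ?gt_eqF.
have s0 : 0 <= s by rewrite /s divr_ge0 // ltW.
have st : s <= t by nra.
have pE : (1 - s) * A p + s * B p = 0 by lra.
exists s; split; [by apply/andP; split=> //; lra| |by right; exists p; rewrite ?mem_head].
move=> r; rewrite inE => /predU1P[->|rl]; first by rewrite pE.
have Ar : 0 < A r by apply: A0; rewrite inE rl orbT.
have Br := tB r rl; nra.
Qed.

Lemma convex_bounds (R : realFieldType) (a b x y t : R) :
  0 <= t <= 1 -> a <= x <= b -> a <= y <= b -> a <= (1 - t) * x + t * y <= b.
Proof.
move=> /andP[t0 t1] /andP[ax xb] /andP[ay yb].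
have s0 : 0 <= 1 - t by rewrite subr_ge0.
have := ler_wpM2l s0 ax; have := ler_wpM2l s0 xb.
have := ler_wpM2l t0 ay; have := ler_wpM2l t0 yb.
by move=> *; apply/andP; split; lra.
Qed.

Lemma ex_small (R : realFieldType) (X : eqType) (l : seq X) (P : X -> R -> Prop) :
  {in l, forall w, exists2 e, 0 < e & forall h, 0 < h < e -> P w h} ->
  exists2 e, 0 < e & forall h, 0 < h < e -> {in l, forall w, P w h}.
Proof.
elim: l => [_|w l IH wP]; first by exists 1.
have [|e e0 eP] := IH; first by move=> r rl; apply: wP; rewrite inE rl orbT.
have [d d0 dP] := wP w (mem_head _ _).
exists (Num.min e d) => [|h]; first by rewrite lt_min e0 d0.
rewrite lt_min => /and3P[h0 he hd] r; rewrite inE => /predU1P[->|rl].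
  by apply: dP; rewrite h0.
by apply: eP; rewrite ?h0.
Qed.

Lemma ex_small_affine (R : realFieldType) (A B : R) : 0 < A ->
  exists2 e, 0 < e & forall h, 0 < h < e -> 0 < A + h * B.
Proof.
move=> A0; have B1 : 0 < 1 + `|B| by rewrite ltr_pwDl.
exists (A / (1 + `|B|)) => [|h /andP[h0]]; first by rewrite divr_gt0.
rewrite ltr_pdivlMr // => hA.
have : h * - B <= h * `|B| by apply: ler_wpM2l; [exact: ltW|rewrite -normrN ler_norm].
lra.
Qed.

Section Cells.
Context (R : realType) (X : eqType) (c1 c2 : X -> R).
Implicit Types (W C : seq X) (left : pred X) (g : R * R) (u v w : X).

(* For the line c1 = g.1 + g.2 * c2 this is, up to an additive constant, g.2
   times the parameter of the push of u; it makes sense also for the vertical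
   line g.2 = 0. *)
Definition lval g u : R := Num.max (c1 u - g.1) (g.2 * c2 u).

Definition incident g u : Prop := c1 u = g.1 + g.2 * c2 u.

Definition cell W left (h0 : R) g : Prop :=
  0 <= g.2 <= h0 /\
  {in W, forall w, if left w then c1 w <= g.1 + g.2 * c2 w
                   else g.1 + g.2 * c2 w <= c1 w}.

Definition open_cell W left (h0 : R) g : Prop :=
  0 < g.2 < h0 /\
  {in W, forall w, if left w then c1 w < g.1 + g.2 * c2 w
                   else g.1 + g.2 * c2 w < c1 w}.

Lemma lval_cell W left h0 g w : cell W left h0 g -> w \in W ->
  lval g w = if left w then g.2 * c2 w else c1 w - g.1.
Proof.
move=> [_ gW] /gW; rewrite /lval; case: ifP => _ cw; [apply/max_idPr|apply/max_idPl]; lra.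
Qed.

Lemma open_cellW W left h0 g : open_cell W left h0 g -> cell W left h0 g.
Proof.
move=> [/andP[g0 gh] gW]; split; first by rewrite !ltW.
by move=> w /gW; case: ifP => _ /ltW.
Qed.

Definition segment g g' (t : R) : R * R :=
  ((1 - t) * g.1 + t * g'.1, (1 - t) * g.2 + t * g'.2).

Lemma open_cell_segment W left h0 g g' t : cell W left h0 g ->
  open_cell W left h0 g' -> 0 < t <= 1 -> open_cell W left h0 (segment g g' t).
Proof.
move=> [/andP[g0 gh] gW] [/andP[g'0 g'h] g'W] /andP[t0 t1].
split; first by rewrite /=; apply/andP; split; nra.
by move=> w wW; move: (gW w wW) (g'W w wW); case: ifP => _ a b /=; nra.
Qed.

Lemma lval_segment W left h0 g g' t w : cell W left h0 g ->
  open_cell W left h0 g' -> 0 < t <= 1 -> w \in W ->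
  lval (segment g g' t) w = (1 - t) * lval g w + t * lval g' w.
Proof.
move=> gW g'W t01 wW; have sW := open_cell_segment gW g'W t01.
rewrite (lval_cell (open_cellW sW) wW) (lval_cell (open_cellW g'W) wW) (lval_cell gW wW).
by rewrite /=; case: ifP => _; ring.
Qed.

Definition pivot w (h : R) : R * R := (c1 w - h * c2 w, h).

Lemma incident_pivot w h : incident (pivot w h) w.
Proof. by rewrite /incident /= subrK. Qed.

Lemma cell_pivot W left h0 w h h1 : w \in W -> cell W left h0 (pivot w h) ->
  0 <= h1 <= h0 ->
  exists t, [/\ 0 <= t <= 1, cell W left h0 (pivot w ((1 - t) * h + t * h1)) &
    t = 1 \/ exists y, [/\ y \in W, y <> w &
      incident (pivot w ((1 - t) * h + t * h1)) y]].
Proof.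
move=> wW hW h1h0.
(* [first_hit] starts from strict inequalities, so a second point already on the line is treated
   apart, with no rotation. *)
have [[y [yW yw yh]]|ny] := pselect (exists y, [/\ y \in W, y <> w & incident (pivot w h) y]).
  exists 0; have -> : (1 - 0) * h + 0 * h1 = h by ring.
  by split=> //; [lra|right; exists y].
(* The horizontal offset of [y] from the line through [w], signed to be nonnegative on the side
   prescribed by [left]; it is affine in [k]. *)
pose f k y := (if left y then 1 else -1) * (c1 w - c1 y + k * (c2 y - c2 w)).
have fP k y : (if left y then c1 y <= (pivot w k).1 + (pivot w k).2 * c2 y
               else (pivot w k).1 + (pivot w k).2 * c2 y <= c1 y) <-> 0 <= f k y.
  by rewrite /f /=; case: ifP => _; split; lra.
have f0 k y : f k y = 0 -> incident (pivot w k) y.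
  by rewrite /f /incident /=; case: ifP => _; lra.
have [|t [t01 tf tE]] := @first_hit R X [seq y <- W | y != w] (f h) (f h1).
  move=> y; rewrite mem_filter => /andP[/eqP yw yW].
  have [_ /(_ y yW) /fP] := hW; rewrite le_eqVlt => /predU1P[/esym/f0 yh|//].
  by case: ny; exists y.
have fE y : (1 - t) * f h y + t * f h1 y = f ((1 - t) * h + t * h1) y.
  by rewrite /f; ring.
exists t; split=> //.
  split; first by apply: convex_bounds => //; case: hW.
  move=> y yW; apply/fP; have [->|yw] := eqVneq y w.
    by rewrite /f; lra.
  by rewrite -fE tf // mem_filter yw.
case: tE => [->|[y +]]; first by left.
rewrite mem_filter fE => /andP[/eqP yw yW] /f0 yh.
by right; exists y.
Qed.

(** The first point met is the left point whose parallel line has the largest intercept. *)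
Lemma slide_left W left h0 g v : cell W left h0 g -> v \in W -> left v ->
  exists w, [/\ w \in W, left w, cell W left h0 (pivot w g.2) &
    c1 w - g.2 * c2 w <= g.1].
Proof.
move=> [gh gW] vW vl.
have [|_ [/mapP[w + ->] _ wmax]] :=
    @ex_max_in R [seq c1 w - g.2 * c2 w | w <- W & left w] predT.
  by rewrite has_predT size_map size_filter -has_count; apply/hasP; exists v.
rewrite mem_filter => /andP[wl wW].
have wg : c1 w - g.2 * c2 w <= g.1 by have := gW w wW; rewrite wl; lra.
exists w; split=> //; split=> // y yW /=; case: ifP => yl.
  have : c1 y - g.2 * c2 y <= c1 w - g.2 * c2 w.
    by apply: wmax => //; apply/mapP; exists y; rewrite // mem_filter yl.
  lra.
by have := gW y yW; rewrite yl; lra.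
Qed.

Lemma slide_right W left h0 g v : cell W left h0 g -> v \in W ->
  {in W, forall w, ~~ left w} ->
  exists2 w, w \in W & cell W left h0 (pivot w g.2).
Proof.
move=> [gh gW] vW nl.
have [|_ [/mapP[w wW ->] _ wmin]] :=
    @ex_min_in R [seq c1 w - g.2 * c2 w | w <- W] predT.
  by rewrite has_predT size_map; case: (W) vW.
exists w => //; split=> // y yW /=; rewrite (negPf (nl y yW)).
have : c1 w - g.2 * c2 w <= c1 y - g.2 * c2 y by apply: wmin => //; apply/mapP; exists y.
lra.
Qed.

(* The points to the left of all sufficiently steep lines through (x, y). *)
Definition left_of (x y : R) : pred X :=
  fun w => (c1 w < x) || ((c1 w == x) && (y < c2 w)).

(** As (x, y) avoids [W], a point with first coordinate [x] lies strictly on one side, decided by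
    its height; any other point does so once [h] is small. *)
Lemma steep_open_cell W (x y h0 : R) : 0 < h0 ->
  {in W, forall w, c1 w = x -> c2 w <> y} ->
  exists2 e, 0 < e &
    forall h, 0 < h < e -> open_cell W (left_of x y) h0 (x - h * y, h).
Proof.
move=> h00 ny.
have [|e e0 eP] := @ex_small R X W (fun w h => if left_of x y w
    then c1 w < x - h * y + h * c2 w else x - h * y + h * c2 w < c1 w).
  move=> w wW; rewrite /left_of; have := ny w wW.
  case: (ltgtP (c1 w) x) => [wx _|wx _|-> /(_ erefl) /eqP] /=.
  - have [|e e0 eP] := @ex_small_affine R (x - c1 w) (c2 w - y); first lra.
    by exists e => // h /eP; lra.
  - have [|e e0 eP] := @ex_small_affine R (c1 w - x) (y - c2 w); first lra.
    by exists e => // h /eP; lra.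
  - case: (ltgtP (c2 w) y) => //= wy _; exists 1 => // h /andP[h1 _]; nra.
exists (Num.min e h0) => [|h]; first by rewrite lt_min e0.
rewrite lt_min => /and3P[h1 he hh0]; split; first by rewrite /= h1.
by move=> w wW /=; apply: eP; rewrite ?h1.
Qed.

(** Here (x, r) may belong to [W], so only the closed cell is reached; [y] plays the role of a
    height just below [r]. *)
Lemma steep_cell W (x y r h0 : R) : 0 < h0 ->
  {in W, forall w, (y < c2 w) = (r <= c2 w)} ->
  exists2 e, 0 < e &
    forall h, 0 < h < e -> cell W (left_of x y) h0 (x - h * r, h).
Proof.
move=> h00 yr.
have [|e e0 eP] := @ex_small R X W (fun w h => if left_of x y w
    then c1 w <= x - h * r + h * c2 w else x - h * r + h * c2 w <= c1 w).
  move=> w wW; rewrite /left_of yr //.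
  case: (ltgtP (c1 w) x) => [wx|wx|->] /=.
  - have [|e e0 eP] := @ex_small_affine R (x - c1 w) (c2 w - r); first lra.
    by exists e => // h /eP; lra.
  - have [|e e0 eP] := @ex_small_affine R (c1 w - x) (r - c2 w); first lra.
    by exists e => // h /eP; lra.
  - by case: leP => wy; exists 1 => // h /andP[h1 _]; nra.
exists (Num.min e h0) => [|h]; first by rewrite lt_min e0.
rewrite lt_min => /and3P[h1 he hh0]; split; first by rewrite /= !ltW.
by move=> w wW /=; apply: eP; rewrite ?h1.
Qed.

Lemma vertical_cell W (x y h0 : R) : 0 < h0 -> cell W (left_of x y) h0 (x, 0).
Proof.
move=> h00; split; first by rewrite /= lexx ltW.
move=> w wW; rewrite /= mul0r addr0 /left_of.
by case: ifPn => [/orP[/ltW//|/andP[/eqP->]]//|]; rewrite negb_or -leNgt => /andP[].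
Qed.

End Cells.

Lemma inv_12_gt0 (R : realFieldType) (n : nat) :
  n \in [:: 1; 2]%N -> 0 < n%:R^-1 :> R.
Proof. by rewrite !inE => /orP[] /eqP ->; rewrite invr_gt0 ltr0n. Qed.

(** * The value of a vertical line and the search for a candidate *)

Section Core.
Context (R : realType) (X : eqType) (c1 c2 : X -> R) (W CM CN : seq X).
Context (rkM rkN : seq X -> seq X -> nat) (h0 : R) (wd : R * R -> \bar R).

Local Notation lval := (lval c1 c2).
Local Notation cell left := (cell c1 c2 W left h0).
Local Notation open_cell left := (open_cell c1 c2 W left h0).
Local Notation C := (CM ++ CN).

Definition dgm_over (q : X -> R) (rk : seq X -> seq X -> nat) (V : seq X)
    (D : seq (R * \bar R)) : Prop :=
  is_rank_dgm V rk q D /\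
  forall p, p \in D -> p.1 \in [seq q u | u <- V] /\
    p.2 \in +oo%E :: [seq t%:E | t <- [seq q u | u <- V]].

Context (h0_range : 0 < h0 <= 1) (CW : {subset C <= W}) (u0 : X) (u0C : u0 \in C).

Context (sign_const : forall left g g', open_cell left g -> open_cell left g' ->
  forall u v w x (m n : nat), u \in C -> v \in C -> w \in C -> x \in C ->
  m \in [:: 1; 2]%N -> n \in [:: 1; 2]%N ->
  Num.sg (`|lval g u - lval g v| / m%:R - `|lval g w - lval g x| / n%:R) =
  Num.sg (`|lval g' u - lval g' v| / m%:R - `|lval g' w - lval g' x| / n%:R)).

Context (wdE : forall g, 0 < g.2 <= 1 -> exists q c DM DN,
  [/\ forall u, lval g u = g.2 * q u + c, dgm_over q rkM CM DM,
      dgm_over q rkN CN DN & wd g = (g.2%:E * bottleneck DM DN)%E]).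

(** Constancy of signs of absolute differences tells only whether two values are equal throughout
    the open cell. An order reversal at [g] would give a zero inside the segment, hence zeros on all
    of it except perhaps at [g]; by affinity also at [g], a contradiction. *)
Lemma cell_order left g g' : cell left g -> open_cell left g' ->
  order_preserving C (lval g') (lval g).
Proof.
move=> gc g'c u v uC vC; have [uW vW] := (CW uC, CW vC).
set a := lval g u - lval g v; set b := lval g' u - lval g' v.
rewrite -subr_le0 -/b => b0; rewrite -subr_le0 -/a leNgt; apply/negP => a0.
have segE t : 0 < t <= 1 ->
    lval (segment g g' t) u - lval (segment g g' t) v = (1 - t) * a + t * b.
  move=> t01; rewrite !(lval_segment gc g'c t01) // /a /b; ring.
have zero s t : 0 < s <= 1 -> 0 < t <= 1 ->
    (1 - s) * a + s * b = 0 -> (1 - t) * a + t * b = 0.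
  move=> s01 t01 sz.
  have := sign_const (open_cell_segment gc g'c s01) (open_cell_segment gc g'c t01)
    (m := 1) (n := 1) uC vC uC uC isT isT.
  rewrite !segE // sz !(subrr, normr0, mul0r, subr0, divr1) sgr0.
  by move=> /esym /eqP; rewrite sgr_eq0 normr_eq0 => /eqP.
have ab : 0 < a - b by lra.
have s01 : 0 < a / (a - b) <= 1.
  by rewrite divr_gt0 //= ler_pdivrMr // mul1r; lra.
have sz : (1 - a / (a - b)) * a + a / (a - b) * b = 0.
  by field; rewrite gt_eqF.
have z1 := zero _ 1 s01 _ sz; have z2 := zero _ 2^-1 s01 _ sz.
have : a = 0 by have := z1 ltac:(lra); have := z2 ltac:(lra); lra.
by move=> az; rewrite az ltxx in a0.
Qed.

(** The inequality holds along the segment from [g'] up to, but excluding, [g], and passes to the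
    limit. *)
Lemma cell_term_order left g g' : cell left g -> open_cell left g' ->
  term_order_preserving C (lval g') (lval g).
Proof.
move=> gc g'c [[[u v] m]|] [[[w x] n]|] //=; last by move=> *; rewrite leey.
move=> [uC vC mP] [wC xC nP]; rewrite !lee_fin => le1.
have m0 : 0 < m%:R^-1 :> R by exact: inv_12_gt0.
have n0 : 0 < n%:R^-1 :> R by exact: inv_12_gt0.
set a := lval g u - lval g v; set b := lval g w - lval g x.
set a' := lval g' u - lval g' v in le1; set b' := lval g' w - lval g' x in le1.
set i := m%:R^-1 in le1 m0 *; set j := n%:R^-1 in le1 n0 *.
have seg_le t : 0 < t <= 1 ->
    `|(1 - t) * a + t * a'| * i <= `|(1 - t) * b + t * b'| * j.
  move=> t01; have := sign_const g'c (open_cell_segment gc g'c t01) uC vC wC xC mP nP.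
  rewrite !(lval_segment gc g'c t01) ?CW // -/a' -/b' -/i -/j.
  have lin p q r s : (1 - t) * p + t * q - ((1 - t) * r + t * s) =
    (1 - t) * (p - r) + t * (q - s) by ring.
  rewrite !lin -/a -/b -/a' -/b' => sgE; rewrite -subr_le0 -sgr_le0 -sgE sgr_le0.
  by rewrite subr_le0.
clearbody a b a' b' i j; rewrite leNgt; apply/negP => gt0.
(* [e] is the violation at [g] and [B] bounds the influence of [g']: at small [t] a violation of at
   least [e - t * (e + B)] would remain. *)
pose e := `|a| * i - `|b| * j; pose B := `|a'| * i + `|b'| * j.
have e0 : 0 < e by rewrite /e subr_gt0.
have B0 : 0 <= B by rewrite /B addr_ge0 // mulr_ge0 // ltW.
have [d d0 dP] := ex_small_affine (- (e + B)) e0.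
pose t := Num.min (d / 2) 1.
have t0 : 0 < t by rewrite /t lt_min ltr01 divr_gt0.
have t1 : t <= 1 by rewrite /t ge_min lexx orbT.
have td : t < d by rewrite /t gt_min; apply/orP; left; lra.
have := dP t; rewrite t0 td => /(_ isT) eB.
have := seg_le t; rewrite t0 t1 => /(_ isT).
have := ler_normB ((1 - t) * a + t * a') (t * a'); rewrite addrK => na.
have := ler_normD ((1 - t) * b) (t * b').
move: na; rewrite !normrM !(gtr0_norm t0) (ger0_norm (x := 1 - t)) ?subr_ge0 //.
clearbody t => na nb AB.
have := ler_wpM2r (ltW m0) na; have := ler_wpM2r (ltW n0) nb.
by rewrite /e /B in eB; lra.
Qed.

Definition is_vertical_value (x : R) (b : \bar R) : Prop :=
  exists DM DN, [/\ is_rank_dgm CM rkM (lval (x, 0)) DM,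
    is_rank_dgm CN rkN (lval (x, 0)) DN & b = bottleneck DM DN].

(** The diagrams at [g0], written symbolically, yield those of every line of the closed cell by
    transport, and the term attaining the distance is transported with them. *)
Lemma cell_value left g0 : open_cell left g0 -> exists i, term_in C i /\
  forall g, cell left g ->
    (0 < g.2 -> wd g = term (lval g) i) /\
    (g.2 = 0 -> is_vertical_value g.1 (term (lval g) i) /\
      forall b, is_vertical_value g.1 b -> b = term (lval g) i).
Proof.
move=> g0c; have /andP[h00 h01] := h0_range.
have g01 : 0 < g0.2 <= 1.
  by have [/andP[-> /ltW gh] _] := g0c; rewrite (le_trans gh).
have [q0 [k0 [DM0 [DN0 [q0E [dM0 eM0] [dN0 eN0] _]]]]] := wdE g01.
have [SM [DM0E SMC]] := ex_symbolic eM0; have [SN [DN0E SNC]] := ex_symbolic eN0.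
rewrite {}DM0E in dM0 eM0; rewrite {}DN0E in dN0 eN0.
have g0p : 0 < g0.2 by case/andP: g01.
have q0_mono u v : (q0 u <= q0 v) = (lval g0 u <= lval g0 v).
  by rewrite !q0E lerD2r ler_pM2l.
have term0 i : term (lval g0) i = (g0.2%:E * term q0 i)%E.
  case: i => [[[u v] n]|] /=; last by rewrite gt0_muley ?lte_fin.
  by rewrite !q0E opprD addrACA subrr addr0 -mulrBr normrM gtr0_norm // -EFinM mulrA.
have ordM g : cell left g -> order_preserving CM q0 (lval g).
  move=> gc u v uC vC; rewrite q0_mono; apply: (cell_order gc g0c);
  by rewrite mem_cat ?uC ?vC.
have ordN g : cell left g -> order_preserving CN q0 (lval g).
  move=> gc u v uC vC; rewrite q0_mono; apply: (cell_order gc g0c);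
  by rewrite mem_cat ?uC ?vC orbT.
have ordT g : cell left g -> term_order_preserving C q0 (lval g).
  move=> gc i j iC jC ij; apply: (cell_term_order gc g0c) => //.
  by rewrite !term0 lee_wpmul2l // lee_fin ltW.
have [pM _] := dM0; have [pN _] := dN0.
have ordTid : term_order_preserving C q0 q0 by [].
have [i [iC iE _]] := bottleneck_term u0C ordTid (fun _ _ _ _ h => h)
  (fun _ _ _ _ h => h) SMC SNC pM pN.
exists i; split=> // g gc.
(* The index [j] obtained for [g] may differ from [i], but their terms agree under [q0], hence, by
   order preservation both ways, under [lval g]. *)
have valE : bottleneck (value_dgm (lval g) SM) (value_dgm (lval g) SN) = term (lval g) i.
  have [j [jC jE ->]] := bottleneck_term u0C (ordT g gc) (ordM g gc) (ordN g gc)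
    SMC SNC pM pN.
  by apply/eqP; rewrite eq_le !(ordT g gc) // -jE -iE.
split=> [g0'|gz].
  have g1 : 0 < g.2 <= 1.
    by have [/andP[_ gh] _] := gc; rewrite g0' (le_trans gh).
  have [q [k [DM [DN [qE [dM _] [dN _] ->]]]]] := wdE g1.
  have q_mono u v : (q u <= q v) = (lval g u <= lval g v).
    by rewrite !qE lerD2r ler_pM2l.
  have oM : order_preserving CM q0 q by move=> u v uC vC /(ordM g gc u v uC vC); rewrite q_mono.
  have oN : order_preserving CN q0 q by move=> u v uC vC /(ordN g gc u v uC vC); rewrite q_mono.
  by rewrite (bottleneck_value_dgm oM oN SMC SNC dM0 dN0 dM dN) -(bottleneck_affine _ _ g0' qE).
have gE : g = (g.1, 0) by rewrite -gz; case: (g).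
split=> [|b [DM [DN [dM dN ->]]]]; last first.
  rewrite -gE in dM dN; rewrite -valE.
  exact: bottleneck_value_dgm (ordM g gc) (ordN g gc) SMC SNC dM0 dN0 dM dN.
have dM := is_rank_dgm_transport (ordM g gc) SMC dM0.
have dN := is_rank_dgm_transport (ordN g gc) SNC dN0.
exists [seq p <- value_dgm (lval g) SM | ~~ diagonal p].
exists [seq p <- value_dgm (lval g) SN | ~~ diagonal p].
rewrite -gE; split=> //; rewrite -valE.
exact: bottleneck_perm_filter.
Qed.

(** The default is never taken: each (x, 0) lies in the closure of a nonempty open cell, where
    [cell_value] gives existence and uniqueness. *)
Definition vertical_value (x : R) : \bar R := xget 0%E (is_vertical_value x).

Lemma cell_valueE left g0 : open_cell left g0 -> exists i, term_in C i /\
  forall g, cell left g ->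
    (0 < g.2 -> wd g = term (lval g) i) /\
    (g.2 = 0 -> vertical_value g.1 = term (lval g) i).
Proof.
move=> /cell_value[i [iC iP]]; exists i; split=> // g /iP[gp gz]; split=> // /gz[v1 v2].
by apply: xget_unique => // b; exact: v2.
Qed.

Definition candidate g : Prop := exists2 w, w \in W & incident c1 c2 g w /\
  (g.2 = h0 \/ exists y, [/\ y \in W, y <> w & incident c1 c2 g y]).

Lemma pivot_up left w h : w \in W -> cell left (pivot c1 c2 w h) ->
  exists h', [/\ h <= h' <= h0, cell left (pivot c1 c2 w h') & candidate (pivot c1 c2 w h')].
Proof.
move=> wW wc; have /andP[h00 _] := h0_range; have [/andP[/= h_ge hh0] _] := wc.
have [|t [t01 tc tE]] := cell_pivot wW wc (h1 := h0); first by rewrite ltW /=.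
exists ((1 - t) * h + t * h0); split=> //.
  by apply: convex_bounds => //; rewrite ?lexx ?hh0.
exists w => //; split; first exact: incident_pivot.
by case: tE => [->|]; [left; rewrite /=; ring|right].
Qed.

(** For cells on which no line costs less than the vertical one, so that any candidate will do. *)
Lemma cell_candidate left g : open_cell left g ->
  exists g', [/\ cell left g', 0 < g'.2 & candidate g'].
Proof.
move=> gc; have [/andP[g0 _] _] := gc; have u0W := CW u0C.
have [w wW wc] : exists2 w, w \in W & cell left (pivot c1 c2 w g.2).
  have [/hasP[v vW vl]|/hasPn nl] := boolP (has left W).
    by have [w [wW _ wc _]] := slide_left (open_cellW gc) vW vl; exists w.
  exact: slide_right (open_cellW gc) u0W nl.
have [h [/andP[gh _] hc hcand]] := pivot_up wW wc.
by exists (pivot c1 c2 w h); split=> //; exact: lt_le_trans gh.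
Qed.

Lemma exists_candidate (x : R) : exists g,
  [/\ 0 < g.2 <= h0, candidate g & (vertical_value x <= wd g)%E].
Proof.
have /andP[h00 _] := h0_range.
have [n] := ubnP (count (fun w => c1 w < x) W).
elim: n x => // n IH x /ltnSE xn.
have [y' y'P] := ex_upper [seq c2 w | w <- W].
(* A height above all of [W]: points on the vertical line itself then count as right of it, and only
   those with [c1 w < x] as left. *)
pose y := y' + 1; have yW w : w \in W -> c2 w < y.
  by move=> wW; have := y'P _ (map_f _ wW); rewrite /y; lra.
pose left := left_of c1 c2 x y.
have leftE w : w \in W -> left w = (c1 w < x).
  by move=> wW; rewrite /left /left_of [y < _]ltNge (ltW (yW w wW)) andbF orbF.
have [|e e0 eP] := steep_open_cell (W := W) (c1 := c1) (c2 := c2) (x := x) (y := y) h00.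
  by move=> w wW _ wy; have := yW w wW; rewrite wy ltxx.
pose g0 : R * R := (x - e / 2 * y, e / 2).
have g0c : open_cell left g0 by apply: eP; apply/andP; split; lra.
have xc : cell left (x, 0) by exact: vertical_cell.
have [i [iC iP]] := cell_valueE g0c.
have wdT g : cell left g -> 0 < g.2 -> wd g = term (lval g) i by move=> /iP[].
have vT z : cell left (z, 0) -> vertical_value z = term (lval (z, 0)) i.
  by move=> /iP[_ /(_ erefl)].
have hrange g : cell left g -> 0 < g.2 -> 0 < g.2 <= h0 by move=> [/andP[_ ->] _] ->.
have any : (forall g, cell left g -> 0 < g.2 ->
      (term (lval (x, 0%R)) i <= term (lval g) i)%E) ->
    exists g, [/\ 0 < g.2 <= h0, candidate g & (vertical_value x <= wd g)%E].
  move=> anyP; have [g [gc gp gcand]] := cell_candidate g0c.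
  by exists g; split; rewrite ?hrange // vT // wdT // anyP.
case: i iC iP wdT vT any => [[[u v] m] [uC vC mP]|_] _ wdT vT any; last first.
  by apply: any.
have m0 : 0 < m%:R^-1 :> R by exact: inv_12_gt0.
wlog uv : u v uC vC wdT vT any / left u ==> left v.
  move=> wl; case: (boolP (left u ==> left v)) => [|/[!negb_imply] /andP[ul vl]].
    exact: wl.
  have sym g : term (lval g) (Some (v, u, m)) = term (lval g) (Some (u, v, m)).
    by rewrite /= distrC.
  apply: (wl v u) => //.
  - by move=> g gc gp; rewrite sym wdT.
  - by move=> z zc; rewrite sym vT.
  - by move=> anyP; apply: any => g gc gp; have := anyP g gc gp; rewrite !sym.
  - by rewrite (negPf vl).
have [uW vW] := (CW uC, CW vC).
have [ul|ur] := boolP (left u).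
  apply: any => g gc gp; rewrite /= lee_fin !(lval_cell xc) // ul (implyP uv ul) /=.
  by rewrite !mul0r subrr normr0 mul0r mulr_ge0 // ltW.
have [vl|vr] := boolP (left v); last first.
  apply: any => g gc gp; rewrite /= lee_fin !(lval_cell xc) ?(lval_cell gc) //.
  rewrite (negPf ur) (negPf vr) /=; apply: ler_wpM2r; first exact: ltW.
  by rewrite !opprB !addrA !subrK.
have xu : x <= c1 u by move: ur; rewrite leftE // -leNgt.
(* With [u] right and [v] left, the term measures [c1 u] against [g.1 + g.2 * c2 v], the abscissa of
   the line at the height of [v]. Moving that abscissa left of [x] can only increase it. *)
have better g : cell left g -> g.1 + g.2 * c2 v <= x ->
    (term (lval (x, 0%R)) (Some (u, v, m)) <= term (lval g) (Some (u, v, m)))%E.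
  move=> gc gx; rewrite /= lee_fin !(lval_cell xc) ?(lval_cell gc) //.
  rewrite (negPf ur) vl /= mul0r subr0; apply: ler_wpM2r; first exact: ltW.
  by rewrite ger0_norm ?subr_ge0 //; apply: le_trans (ler_norm _); lra.
have [w [wW wl wc wg]] := slide_left (open_cellW g0c) vW vl.
rewrite /= in wc wg; set h := e / 2 in wc wg.
have hp : 0 < h by rewrite /h divr_gt0.
(* The line [g0] passes through (x, y), above [v], so it is left of [x] at the height of [v];
   sliding left keeps this. *)
have wx : c1 w - h * c2 w + h * c2 v <= x.
  apply: (@le_trans _ _ (x - h * y + h * c2 v)); first by rewrite lerD2r.
  by rewrite -addrA gerDl -mulrN -mulrDr pmulr_rle0 //; have := yW v vW; lra.
(* The relative height of the pivot [w] and [v] decides which rotation moves the line left at [v]: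
   increasing [h] if [w] is at least as high, otherwise towards the vertical. *)
have [vw|wv] := leP (c2 v) (c2 w).
  have [h' [/andP[hh' _] h'c h'cand]] := pivot_up wW wc.
  have h'p : 0 < h' := lt_le_trans hp hh'.
  exists (pivot c1 c2 w h'); split; rewrite ?hrange // vT // wdT //.
  have mono : (h' - h) * c2 v <= (h' - h) * c2 w by rewrite ler_wpM2l // subr_ge0.
  by apply: better => //=; lra.
have [|t [/andP[t0 t1] tc tE]] := cell_pivot wW wc (h1 := 0); first by rewrite lexx ltW.
set h' := (1 - t) * h + t * 0 in tc tE.
have h'E : h' = (1 - t) * h by rewrite /h' mulr0 addr0.
have h'x : c1 w - h' * c2 w + h' * c2 v <= x.
  have mono : t * h * c2 w <= t * h * c2 v.
    by apply: ler_wpM2l; [rewrite mulr_ge0 // ltW|exact: ltW].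
  by rewrite h'E; lra.
have [tt|nt] := eqVneq t 1.
  have h'0 : h' = 0 by rewrite h'E tt subrr mul0r.
  have pE : pivot c1 c2 w h' = (c1 w, 0) by rewrite /pivot h'0 mul0r subr0.
  rewrite pE in tc.
  (* The count drops because [w] is left of [x] but not of itself. *)
  have [|g [g1 g2 g3]] := IH (c1 w).
    apply: leq_trans xn; move: wl; rewrite leftE // => wlx.
    rewrite [X in (_ < X)%N](@count_add _ _ (fun z => c1 z < c1 w)
      (fun z => (c1 w <= c1 z) && (c1 z < x))).
      by rewrite -addn1 leq_add2l -has_count; apply/hasP; exists w; rewrite ?lexx.
    move=> z _; case: (ltP (c1 z) (c1 w)) => //= zw; by rewrite (lt_trans zw wlx).
  exists g; split=> //; apply: le_trans g3; rewrite !vT //; apply: better => //=.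
  by move: h'x; rewrite h'0; lra.
have h'p : 0 < h'.
  by rewrite h'E mulr_gt0 // subr_gt0 lt_neqAle nt.
exists (pivot c1 c2 w h'); split; rewrite ?hrange //.
  case: tE => [tt|yE]; first by rewrite tt eqxx in nt.
  by exists w => //; split; [exact: incident_pivot|right].
by rewrite vT // wdT //; apply: better.
Qed.

Lemma cvg_vertical_value (x r : R) :
  wd (x - t * r, t) @[t --> 0^'+] --> vertical_value x.
Proof.
have /andP[h00 _] := h0_range.
have [z zr zP] := ex_below [seq c2 w | w <- W] r.
(* Strictly between [r] and the heights of [W] below it, so that (x, y) avoids [W] and the steep
   lines through (x, r) lie in the closed cell of (x, y). *)
pose y := (z + r) / 2; have [zy yr] : z < y /\ y < r by rewrite /y; split; lra.
have yE : {in W, forall w, (y < c2 w) = (r <= c2 w)}.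
  move=> w wW; have := zP _ (map_f _ wW); case: (ltP (c2 w) r) => [_ /(_ isT) wz|rw _].
    by rewrite ltNge (le_trans wz (ltW zy)).
  by rewrite (lt_le_trans yr rw).
have [|e e0 eP] := steep_open_cell (W := W) (c1 := c1) (c2 := c2) (x := x) (y := y) h00.
  move=> w wW _ wy; have := yE w wW; rewrite wy ltxx => /esym/negbT.
  by rewrite -ltNge => _; have := zP _ (map_f _ wW); rewrite wy yr => /(_ isT); lra.
have [i [iC iP]] := cell_valueE (eP (e / 2) ltac:(lra)).
have xc : cell (left_of c1 c2 x y) (x, 0) by exact: vertical_cell.
have [e' e'0 e'P] := @steep_cell R X c1 c2 W x y r h0 h00 yE.
have [_ /(_ erefl) /= ->] := iP _ xc.
have near_e : \forall t \near 0^'+, 0 < t < e'.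
  near=> t; apply/andP; split; near: t; first exact: nbhs_right_gt.
  exact: nbhs_right_lt.
apply: (@cvg_trans _ (term (lval (x - t * r, t)) i @[t --> 0^'+])).
  apply: near_eq_cvg; near=> t.
  have t0e : 0 < t < e' by near: t.
  have [-> //] := iP _ (e'P t t0e).
  by case/andP: t0e.
case: i iC {iP} => [[[u v] n] [uC vC _]|_]; last exact: cvg_cst.
have aff w : w \in W -> exists b, forall t, 0 < t < e' ->
    lval (x - t * r, t) w = lval (x, 0) w + t * b.
  move=> wW; exists (if left_of c1 c2 x y w then c2 w else r) => t /e'P tc.
  rewrite (lval_cell tc) // (lval_cell xc) //=; case: ifP => _; ring.
have [bu buE] := aff u (CW uC); have [bv bvE] := aff v (CW vC).
set a := lval (x, 0) u - lval (x, 0) v.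
apply: (@cvg_trans _ ((`|a + t * (bu - bv)| / n%:R)%:E @[t --> 0^'+])).
  apply: near_eq_cvg; near=> t.
  have t0e : 0 < t < e' by near: t.
  by rewrite /= buE // bvE //; congr (`|_| / _)%:E; rewrite /a; ring.
apply: cvg_EFin; first by near=> t.
apply: cvgMr_tmp; apply: cvg_norm.
rewrite -[X in _ --> X]addr0; apply: cvgD; first exact: cvg_cst.
rewrite -[X in _ --> X](mul0r (bu - bv)); apply: cvgMr_tmp.
apply: cvg_at_right_filter; exact: cvg_id.
Unshelve. all: by end_near. Qed.

End Core.

(** * Restrictions of bimodules to lines *)

Section RestrictionDiagram.
Context (R : realType) (F : fieldType).
Implicit Types (M : bimodule R F) (L : posline R) (S T V : seq (R * R)).

(** For empty [S] the default 0 is the rank that property P prescribes below all critical points. *)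
Definition rank_between M S T : nat :=
  xget 0%N [set n | exists bu bv (buv : (bu <= bv)%O),
    [/\ is_max [set` S] bu, is_max [set` T] bv & n = prank M buv]].

Lemma is_max_unique (A : set (R * R)) u v : is_max A u -> is_max A v -> u = v.
Proof. by move=> [Au uA] [Av vA]; apply/le_anti; rewrite vA // uA. Qed.

Lemma rank_betweenE M S T bu bv (buv : (bu <= bv)%O) :
  is_max [set` S] bu -> is_max [set` T] bv -> rank_between M S T = prank M buv.
Proof.
move=> mS mT; apply: xget_unique => /=; first by exists bu, bv, buv.
move=> n [bu' [bv' [buv' [mS' mT' ->]]]].
have E1 := is_max_unique mS mS'; have E2 := is_max_unique mT mT'.
by subst bu' bv'; rewrite (bool_irrelevance buv' buv).
Qed.

Lemma rank_between_nil M T : rank_between M [::] T = 0%N.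
Proof. by apply: xgetPN => n /= -[bu [bv [buv [[]]]]]. Qed.

(** This adjunction turns the sets [below CM (lpoint L s)] into sublevel sets of the push
    parameter. *)
Lemma push_param_le L u (s : R) : (push_param L u <= s) = (u <= lpoint L s)%O.
Proof.
have m1 := ldir1_gt0 L; have m2 := ldir2_gt0 L.
rewrite push_paramE ge_max leEprod /= -!lerBlDr ![_ * s]mulrC.
by rewrite -!ler_pdivrMr.
Qed.

Lemma prank_id d (U : porderType d) (N : pmodule U F) u (uu : (u <= u)%O) :
  prank N uu = \dim {: pobj N u}.
Proof. by rewrite /prank pmap_id lim1g. Qed.

Lemma prank_restr M (CM : set (R * R)) V L (s t : R) (st : (s <= t)%O) :
  property_P M CM -> lub_closure CM = [set` V] ->
  prank (restr M L) st =
  rank_between M [seq u <- V | push_param L u <= s] [seq u <- V | push_param L u <= t].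
Proof.
move=> [_ _ P1 P2] CV.
have belowE (x : R) : below CM (lpoint L x) = [set` [seq u <- V | push_param L u <= x]].
  apply/seteqP; split => u /=.
    by rewrite /below CV /= mem_filter push_param_le => -[-> ->].
  by rewrite /below CV /= mem_filter push_param_le => /andP[-> ->].
have [be|bne] := eqVneq (below CM (lpoint L s)) set0.
  have := P2 _ _ (lpoint_homo L st) be; rewrite -[LHS]/(prank (restr M L) st) => ->.
  move: be; rewrite belowE; case: [seq _ <- _ | _] => [_|u S /seteqP[/(_ u)]].
    by rewrite rank_between_nil.
  by rewrite /= mem_head => /(_ isT).
have [bu [bv [buv [mu mv E]]]] := P1 _ _ (lpoint_homo L st) ((set0P _).1 bne).
rewrite -[LHS]/(prank M (lpoint_homo L st)) E.
by rewrite !belowE in mu mv; rewrite (rank_betweenE _ buv mu mv).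
Qed.

(** If no push lies in (s, t], the sublevel sets at [s] and [t] agree, so the rank of the map equals
    both dimensions and the map is an isomorphism. Hence a decomposition exists, and ranks identify
    the chosen diagram with it up to order. *)
Lemma dgm_restr M (CM : set (R * R)) V L :
  property_P M CM -> lub_closure CM = [set` V] ->
  dgm_over (push_param L) (rank_between M) V (dgm (restr M L)).
Proof.
move=> PM CV; pose q := push_param L.
have rkE s t (st : (s <= t)%O) := prank_restr L st PM CV.
have [||D0 [D0M D0e]] := @ex_is_dgm R F (restr M L) [seq q u | u <- V].
- move=> s sV; rewrite -(prank_id _ (lexx s)) rkE.
  rewrite (_ : [seq u <- V | push_param L u <= s] = [::]) ?rank_between_nil //.
  rewrite -(filter_pred0 V); apply: eq_in_filter => u uV /=.
  by apply/negbTE; rewrite -ltNge sV // map_f.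
- move=> s t st stV; have VE : [seq u <- V | push_param L u <= s] =
      [seq u <- V | push_param L u <= t].
    apply: eq_in_filter => u uV; apply/idP/idP => [us|ut]; first exact: le_trans us st.
    rewrite leNgt; apply/negP => su.
    by have := stV _ (map_f q uV); rewrite su ut.
  have dims : \dim (limg (pmap (restr M L) st)) = \dim {: pobj (restr M L) s}.
    by rewrite -(prank_id _ (lexx s)) -[LHS]/(prank (restr M L) st) !rkE VE.
  have dimt : \dim (limg (pmap (restr M L) st)) = \dim {: pobj (restr M L) t}.
    by rewrite -(prank_id _ (lexx t)) -[LHS]/(prank (restr M L) st) !rkE VE.
  split; last by apply/eqP; rewrite eqEdim subvf dimt /=.
  apply/eqP; rewrite -dimv_eq0 -(eqn_add2r (\dim (limg (pmap (restr M L) st)))).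
  by rewrite -{1}[lker _]capfv limg_ker_dim dims.
have rank_dgm D : is_dgm (restr M L) D -> is_rank_dgm V (rank_between M) q D.
  move=> [pD iso]; split=> // s t st.
  by rewrite -(rkE s t st) (prank_iso st iso) prank_pdsum_interval.
have dM : is_dgm (restr M L) (dgm (restr M L)) by apply: xgetPex; exists D0.
split; first exact: rank_dgm.
have [p0 c0] := rank_dgm _ D0M; have [p1 c1] := rank_dgm _ dM.
have /perm_mem E : perm_eq (dgm (restr M L)) D0.
  by apply: rank_count_perm => // s t st; rewrite c0 // c1.
by move=> p; rewrite E; exact: D0e.
Qed.

End RestrictionDiagram.

Section LinesAndPoints.
Context (R : realType).

(** A join takes its coordinates from its arguments, so the closure stays in a finite grid. *)
Lemma lub_closure_finite (C : set (R * R)) : finite_set C ->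
  finite_set (lub_closure C).
Proof.
move=> finC; have fin1 : finite_set (fst @` C) by exact: finite_image.
have fin2 : finite_set (snd @` C) by exact: finite_image.
apply: (sub_finite_set _ (finite_setX fin1 fin2)); apply: smallest_sub.
  move=> [a b] [c d] /= [aC bC] [cC dC]; split => /=.
    by case: (leP a c) => /= _; rewrite ?(join_r) ?join_l.
  by case: (leP b d).
by move=> u uC; split; exists u.
Qed.

(** The two quotients are the parameters at which the line attains the coordinates of [u]; the
    larger one is the push. *)
Lemma recip_above (L : posline R) (u : R * R) :
  (u.1 - (lbase L).1) / (ldir L).1 < (u.2 - (lbase L).2) / (ldir L).2 ->
  recip L (Aff u) = [set 2%N].
Proof.
have m1 := ldir1_gt0 L; have m2 := ldir2_gt0 L; move=> AB.
have noline : ~ on_line L u.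
  move=> [s /= us]; move: AB; rewrite -us /= !addrK ![_ * s]mulrC.
  by rewrite !mulfK ?gt_eqF // ltxx.
rewrite /recip asboolF // /push push_paramE (max_idPr (ltW AB)) /=.
have lt1 : u.1 < (ldir L).1 * ((u.2 - (lbase L).2) / (ldir L).2) + (lbase L).1.
  by rewrite -ltrBlDr mulrC -ltr_pdivrMr.
by rewrite (gt_eqF lt1) /= [(ldir L).2 * _]mulrC divfK ?lt0r_neq0 // subrK eqxx lt1.
Qed.

Lemma recip_below (L : posline R) (u : R * R) :
  (u.2 - (lbase L).2) / (ldir L).2 < (u.1 - (lbase L).1) / (ldir L).1 ->
  recip L (Aff u) = [set 1%N].
Proof.
have m1 := ldir1_gt0 L; have m2 := ldir2_gt0 L; move=> AB.
have noline : ~ on_line L u.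
  move=> [s /= us]; move: AB; rewrite -us /= !addrK ![_ * s]mulrC.
  by rewrite !mulfK ?gt_eqF // ltxx.
rewrite /recip asboolF // /push push_paramE (max_idPl (ltW AB)) /=.
have lt2 : u.2 < (ldir L).2 * ((u.1 - (lbase L).1) / (ldir L).1) + (lbase L).2.
  by rewrite -ltrBlDr mulrC -ltr_pdivrMr.
by rewrite [(ldir L).1 * _]mulrC divfK ?lt0r_neq0 // subrK eqxx lt2.
Qed.

Lemma posline_eq (L L' : posline R) : ldir L = ldir L' -> lbase L = lbase L' -> L = L'.
Proof.
case: L L' => [d b p1 p2 p3 p4] [d' b' p1' p2' p3' p4'] /= E1 E2; subst d' b'.
by congr PosLine; exact: eq_irrelevance.
Qed.

End LinesAndPoints.

(** * The argument for steep and flat lines at once *)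

Section LineFamily.
Context (R : realType) (F : fieldType) (M N : bimodule R F).
Context (CM CN : set (R * R)) (Omega : set (ppoint R)).
Context (c1 c2 : R * R -> R) (line : R * R -> posline R) (kap : R -> R).
Context (side_lt side_gt slope_side : set nat).

(* [c1] and [c2] are the two coordinates, in an order that depends on whether
   the lines are steep or flat; [line g] is c1 = g.1 + g.2 * c2, and it passes
   through [0:1:t] iff g.2 = kap t. *)

Context (lval_push : forall g, 0 < g.2 <= 1 -> exists c, forall u,
  lval c1 c2 g u = g.2 * push_param (line g) u + c).
Context (mhat_line : forall g, 0 < g.2 <= 1 -> mhat (line g) = g.2).
Context (on_incident : forall g u, 0 < g.2 <= 1 -> incident c1 c2 g u ->
  on_line (line g) u).
Context (recip_lt : forall g u, 0 < g.2 <= 1 -> c1 u < g.1 + g.2 * c2 u ->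
  recip (line g) (Aff u) = side_lt).
Context (recip_gt : forall g u, 0 < g.2 <= 1 -> g.1 + g.2 * c2 u < c1 u ->
  recip (line g) (Aff u) = side_gt).
Context (recip_inf : forall g t, 0 < g.2 <= 1 -> 0 < t -> g.2 < kap t ->
  recip (line g) (Inf t) = slope_side).
Context (passes_inf : forall g t, 0 < g.2 <= 1 -> 0 < t -> g.2 = kap t ->
  passes_through (line g) (Inf t)).
Context (kap_gt0 : forall t, 0 < t -> 0 < kap t) (kap1 : kap 1 = 1).

Lemma line_family_candidate : ~ (ptrivial M /\ ptrivial N) ->
  property_P M CM -> property_P N CN -> property_Q CM CN Omega ->
  exists v : R -> \bar R, forall x,
    (exists L, candidate_line CM CN Omega L /\ (v x <= weighted_dist M N L)%E) /\
    forall r, weighted_dist M N (line (x - t * r, t)) @[t --> 0^'+] --> v x.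
Proof.
move=> nontriv PM PN [finO Oinf Qsign].
have finM : finite_set CM by case: PM.
have finN : finite_set CN by case: PN.
have /finite_seqP[VM VME] := lub_closure_finite finM.
have /finite_seqP[VN VNE] := lub_closure_finite finN.
(* The default values of [aff] and [slope] do not occur, since each is applied only to points of its
   own kind. *)
pose aff P : R * R := if P is Aff u then u else (0, 0).
pose slope P : R := if P is Inf t then t else 1.
pose OP := Omega `&` range (@Aff R).
pose OI := Omega `&` range (@Inf R).
have /finite_seqP[A AE] : finite_set (aff @` OP).
  by apply: finite_image; exact: finite_setIl.
have /finite_seqP[K KE] : finite_set (slope @` OI).
  by apply: finite_image; exact: finite_setIl.
have critE u : crit CM CN u <-> u \in VM ++ VN.
  rewrite /crit VME VNE mem_cat; split; first by case=> uV; apply/orP; [left|right].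
  by move=> /orP[] uV; [left|right].
have AP u : u \in A -> OP (Aff u).
  move=> uA; have : [set` A] u by [].
  by rewrite -AE => -[P [OP' [u' _ uE]]]; rewrite -uE /= => <-; split; [rewrite uE|exists u'].
have PA u : Omega (Aff u) -> u \in A.
  move=> Ou; have : (aff @` OP) u by exists (Aff u) => //; split=> //; exists u.
  by rewrite AE.
have Inf_gt0 t : Omega (Inf t) -> 0 < t.
  move=> /Oinf[[u]//|[v1 [v2 [v10 v20]]]]; rewrite /pinf gt_eqF // => -[->].
  exact: divr_gt0.
have KP t : t \in K -> Omega (Inf t).
  move=> tK; have : [set` K] t by [].
  by rewrite -KE => -[P [OP' [t' _ tE]]]; rewrite -tE /= => <-; rewrite tE.
have PK t : Omega (Inf t) -> t \in K.
  move=> Ot; have : (slope @` OI) t by exists (Inf t) => //; split=> //; exists t.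
  by rewrite KE.
(* Below this minimum every point of [Omega] at infinity has constant reciprocal position. The extra
   slope 1 keeps [h0 <= 1] and accounts for [0:1:1]. *)
have [|_ [/mapP[t0 t0K ->] _ h0min]] := @ex_min_in R [seq kap t | t <- 1 :: K] predT.
  by [].
set h0 := kap t0 in h0min.
have t0_gt0 : 0 < t0.
  by move: t0K; rewrite inE => /predU1P[->|/KP/Inf_gt0].
have h01 : 0 < h0 <= 1.
  by rewrite kap_gt0 //= -kap1 h0min //= inE kap1 eqxx.
have h0_le t : Omega (Inf t) -> h0 <= kap t.
  by move=> /PK tK; rewrite h0min // map_f // inE tK orbT.
pose W := (VM ++ VN) ++ A.
have CW : {subset VM ++ VN <= W} by move=> u uV; rewrite /W mem_cat uV.
have [u0 u0C] : exists u0, u0 \in VM ++ VN.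
  apply: contrapT => nu; apply: nontriv.
  have noneM u : ~ CM u.
    by move=> Cu; apply: nu; exists u; apply/critE; left; exact: sub_gen_smallest.
  have noneN u : ~ CN u.
    by move=> Cu; apply: nu; exists u; apply/critE; right; exact: sub_gen_smallest.
  have [_ [tM _] _ _] := PM; have [_ [tN _] _ _] := PN.
  have CM0 : CM = set0 by apply/seteqP; split=> u // /noneM.
  have CN0 : CN = set0 by apply/seteqP; split=> u // /noneN.
  by split; [exact: tM|exact: tN].
have range1 g left : open_cell c1 c2 W left h0 g -> 0 < g.2 <= 1.
  by case/andP: h01 => _ h0_le1 [/andP[-> gh] _] /=; rewrite (le_trans (ltW gh)).
have equiv left g g' : open_cell c1 c2 W left h0 g -> open_cell c1 c2 W left h0 g' ->
    recip_equiv (@Aff R @` crit CM CN `|` Omega) (line g) (line g').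
  move=> gc g'c; have g1 := range1 _ _ gc; have g'1 := range1 _ _ g'c.
  have affW u : u \in W -> recip (line g) (Aff u) = recip (line g') (Aff u).
    move=> uW; move: (gc.2 u uW) (g'c.2 u uW); case: ifP => _ a b.
      by rewrite !recip_lt.
    by rewrite !recip_gt.
  move=> P [[u /critE uC <-]|]; first exact/affW/CW.
  case: P => [u /PA uA|t Ot|//]; first by apply: affW; rewrite /W mem_cat uA orbT.
  have hk (k : R * R) : open_cell c1 c2 W left h0 k -> k.2 < kap t.
    by move=> [/andP[_ kh] _]; apply: lt_le_trans kh (h0_le t Ot).
  rewrite (recip_inf g1 (Inf_gt0 t Ot) (hk g gc)).
  by rewrite (recip_inf g'1 (Inf_gt0 t Ot) (hk g' g'c)).
pose wd g := weighted_dist M N (line g).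
have sign_const left g g' : open_cell c1 c2 W left h0 g -> open_cell c1 c2 W left h0 g' ->
  forall u v w x (m n : nat), u \in VM ++ VN -> v \in VM ++ VN ->
  w \in VM ++ VN -> x \in VM ++ VN ->
  m \in [:: 1; 2]%N -> n \in [:: 1; 2]%N ->
  Num.sg (`|lval c1 c2 g u - lval c1 c2 g v| / m%:R -
          `|lval c1 c2 g w - lval c1 c2 g x| / n%:R) =
  Num.sg (`|lval c1 c2 g' u - lval c1 c2 g' v| / m%:R -
          `|lval c1 c2 g' w - lval c1 c2 g' x| / n%:R).
  move=> gc g'c u v w x m n /critE uC /critE vC /critE wC /critE xC mP nP.
  (* The additive constant cancels in the differences, and the factor [k.2 > 0] does not affect the
     sign. *)
  have sgE k : 0 < k.2 <= 1 ->
      Num.sg (`|lval c1 c2 k u - lval c1 c2 k v| / m%:R -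
        `|lval c1 c2 k w - lval c1 c2 k x| / n%:R) =
      Num.sg (`|push_param (line k) u - push_param (line k) v| / m%:R -
        `|push_param (line k) w - push_param (line k) x| / n%:R).
    move=> k1; have [c cE] := lval_push k1; have /andP[k0 _] := k1.
    have dE a b : `|k.2 * a + c - (k.2 * b + c)| = k.2 * `|a - b|.
      by rewrite opprD addrACA subrr addr0 -mulrBr normrM gtr0_norm.
    by rewrite !cE !dE -!mulrA -mulrBr sgrM (gtr0_sg k0) mul1r.
  rewrite !sgE ?(range1 _ _ gc) ?(range1 _ _ g'c) //.
  exact: Qsign (equiv _ _ _ gc g'c).
have wdE g : 0 < g.2 <= 1 -> exists q c DM DN,
    [/\ forall u, lval c1 c2 g u = g.2 * q u + c,
        dgm_over q (rank_between M) VM DM, dgm_over q (rank_between N) VN DN &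
        wd g = (g.2%:E * bottleneck DM DN)%E].
  move=> g1; have [c cE] := lval_push g1.
  exists (push_param (line g)), c, (dgm (restr M (line g))), (dgm (restr N (line g))).
  split=> //; [exact: dgm_restr PM VME|exact: dgm_restr PN VNE|].
  by rewrite /wd /weighted_dist mhat_line.
exists (vertical_value c1 c2 VM VN (rank_between M) (rank_between N)) => x.
split; last by move=> r; exact: (cvg_vertical_value h01 CW u0C sign_const wdE).
have [g [/andP[g0 gh] [w wW [wg gcand]] vg]] :=
  exists_candidate h01 CW u0C sign_const wdE x.
have g1 : 0 < g.2 <= 1.
  by rewrite g0 (le_trans gh) //; case/andP: h01.
have affP u : u \in W -> (@Aff R @` crit CM CN `|` OP) (Aff u).
  rewrite /W mem_cat => /orP[/critE uC|/AP uO]; last by right.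
  by left; exists u.
exists (line g); split=> //.
have [gh0|[y [yW yw yg]]] := gcand.
  exists (Aff w), (Inf t0); split=> //; first exact: affP.
  - right; move: t0K; rewrite inE => /predU1P[->|/KP]; last by left.
    by right; rewrite /= /pinf oner_eq0 divr1.
  - exact: on_incident.
  - exact: passes_inf.
exists (Aff w), (Aff y); split; first exact: affP.
- by have [?|[? _]] := affP y yW; [left|right; left].
- by move=> [wy]; apply: yw.
- exact: on_incident.
- exact: on_incident.
Qed.

End LineFamily.

(** * Explicit coordinates of steep and flat lines *)

Section SteepAndFlat.
Context (R : realType).
Implicit Types (g r u : R * R) (L : posline R).

Definition steep g : posline R := steep_line (g.1, 0) g.2.
Definition flat g : posline R := flat_line (0, g.1) g.2.

Lemma clamp_id (h : R) : 0 < h <= 1 -> clamp h = h.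
Proof.
move=> /andP[h0 h1]; rewrite /clamp h0 /=; case: ltP => // h1'.
by apply/eqP; rewrite eq_le h1 h1'.
Qed.

Lemma steepE g : 0 < g.2 <= 1 ->
  exists b, ldir (steep g) = (g.2, 1) /\ lbase (steep g) = (g.1 + g.2 * b, b).
Proof.
move=> g1; exists (lbase (steep g)).2; rewrite /steep /= clamp_id //.
by split=> //; congr (_, _); ring.
Qed.

Lemma flatE g : 0 < g.2 <= 1 ->
  exists b, ldir (flat g) = (1, g.2) /\ lbase (flat g) = (b, g.1 + g.2 * b).
Proof.
move=> g1; exists (lbase (flat g)).1; rewrite /flat /= clamp_id //.
by split=> //; congr (_, _); ring.
Qed.

Lemma steep_lineE r (t : R) : 0 < t <= 1 ->
  steep_line r t = steep (r.1 - t * r.2, t).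
Proof.
move=> /[dup] t1 /andP[t0 _]; apply: posline_eq => //=; rewrite clamp_id //.
by congr (_, _); field; rewrite gt_eqF // addr_gt0.
Qed.

Lemma flat_lineE r (t : R) : 0 < t <= 1 ->
  flat_line r t = flat (r.2 - t * r.1, t).
Proof.
move=> /[dup] t1 /andP[t0 _]; apply: posline_eq => //=; rewrite clamp_id //.
by congr (_, _); field; rewrite gt_eqF // addr_gt0.
Qed.

Lemma mhat_steep g : 0 < g.2 <= 1 -> mhat (steep g) = g.2.
Proof.
by move=> /[dup] /andP[_ g1] /steepE[b [dE _]]; rewrite /mhat dE /=; apply/min_idPl.
Qed.

Lemma mhat_flat g : 0 < g.2 <= 1 -> mhat (flat g) = g.2.
Proof.
by move=> /[dup] /andP[_ g1] /flatE[b [dE _]]; rewrite /mhat dE /=; apply/min_idPr.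
Qed.

Lemma lval_steep g : 0 < g.2 <= 1 -> exists c, forall u,
  lval fst snd g u = g.2 * push_param (steep g) u + c.
Proof.
move=> /[dup] /andP[g0 _] /steepE[b [dE bE]].
exists (g.2 * b) => u.
rewrite push_paramE dE bE /= maxr_pMr ?ltW // addr_maxl /lval.
by congr Num.max; field; rewrite ?gt_eqF.
Qed.

Lemma lval_flat g : 0 < g.2 <= 1 -> exists c, forall u,
  lval snd fst g u = g.2 * push_param (flat g) u + c.
Proof.
move=> /[dup] /andP[g0 _] /flatE[b [dE bE]].
exists (g.2 * b) => u.
rewrite push_paramE dE bE /= maxC maxr_pMr ?ltW // addr_maxl /lval.
by congr Num.max; field; rewrite ?gt_eqF.
Qed.

Lemma on_steep g u : 0 < g.2 <= 1 -> incident fst snd g u -> on_line (steep g) u.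
Proof.
move=> /steepE[b [dE bE]] ug; exists (u.2 - b).
rewrite /lpoint dE bE /=; case: u ug => u1 u2; rewrite /incident /= => ->.
by congr (_, _); ring.
Qed.

Lemma on_flat g u : 0 < g.2 <= 1 -> incident snd fst g u -> on_line (flat g) u.
Proof.
move=> /flatE[b [dE bE]] ug; exists (u.1 - b).
rewrite /lpoint dE bE /=; case: u ug => u1 u2; rewrite /incident /= => ->.
by congr (_, _); ring.
Qed.

Lemma recip_steep_lt g u : 0 < g.2 <= 1 -> u.1 < g.1 + g.2 * u.2 ->
  recip (steep g) (Aff u) = [set 2%N].
Proof.
move=> /[dup] /andP[g0 _] /steepE[b [dE bE]] ug; apply: recip_above.
by rewrite dE bE /= divr1 ltr_pdivrMr //; lra.
Qed.

Lemma recip_steep_gt g u : 0 < g.2 <= 1 -> g.1 + g.2 * u.2 < u.1 ->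
  recip (steep g) (Aff u) = [set 1%N].
Proof.
move=> /[dup] /andP[g0 _] /steepE[b [dE bE]] ug; apply: recip_below.
by rewrite dE bE /= divr1 ltr_pdivlMr //; lra.
Qed.

Lemma recip_flat_lt g u : 0 < g.2 <= 1 -> u.2 < g.1 + g.2 * u.1 ->
  recip (flat g) (Aff u) = [set 1%N].
Proof.
move=> /[dup] /andP[g0 _] /flatE[b [dE bE]] ug; apply: recip_below.
by rewrite dE bE /= divr1 ltr_pdivrMr //; lra.
Qed.

Lemma recip_flat_gt g u : 0 < g.2 <= 1 -> g.1 + g.2 * u.1 < u.2 ->
  recip (flat g) (Aff u) = [set 2%N].
Proof.
move=> /[dup] /andP[g0 _] /flatE[b [dE bE]] ug; apply: recip_above.
by rewrite dE bE /= divr1 ltr_pdivlMr //; lra.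
Qed.

Lemma recip_steep_inf g (t : R) : 0 < g.2 <= 1 -> 0 < t -> g.2 < t^-1 ->
  recip (steep g) (Inf t) = [set 1%N].
Proof.
move=> /[dup] /andP[g0 _] /steepE[b [dE _]] t0; rewrite -[t^-1]div1r ltr_pdivlMr // => gt.
have tg : t < 1 / g.2 by rewrite ltr_pdivlMr // mulrC.
by rewrite /recip dE /= gt_eqF // tg.
Qed.

Lemma recip_flat_inf g (t : R) : 0 < g.2 <= 1 -> 0 < t -> g.2 < t ->
  recip (flat g) (Inf t) = [set 2%N].
Proof.
move=> /flatE[b [dE _]] t0 gt.
by rewrite /recip dE /= divr1 lt_eqF // ltNge (ltW gt).
Qed.

Lemma passes_steep g (t : R) : 0 < g.2 <= 1 -> 0 < t -> g.2 = t^-1 ->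
  passes_through (steep g) (Inf t).
Proof.
move=> /[dup] /andP[g0 _] /steepE[b [dE _]] _ gt.
by rewrite /passes_through dE /pinf /= gt_eqF // gt div1r invrK.
Qed.

Lemma passes_flat g (t : R) : 0 < g.2 <= 1 -> 0 < t -> g.2 = t ->
  passes_through (flat g) (Inf t).
Proof.
move=> /flatE[b [dE _]] _ gt.
by rewrite /passes_through dE /pinf /= oner_eq0 divr1 gt.
Qed.

Lemma near_right_unit : \forall t \near (0 : R)^'+, 0 < t <= 1.
Proof.
near=> t; apply/andP; split; first by near: t; exact: nbhs_right_gt.
by near: t; exact: nbhs_right_le.
Unshelve. all: by end_near. Qed.

End SteepAndFlat.

Theorem corollary3p13 (R : realType) (F : fieldType) (M N : bimodule R F)
    (CM CN : set (R * R)) (Omega : set (ppoint R)) :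
  finitely_presented M -> finitely_presented N ->
  ~ (ptrivial M /\ ptrivial N) ->
  property_P M CM -> property_P N CN ->
  property_Q CM CN Omega ->
  (forall x : R, exists L : posline R,
     candidate_line CM CN Omega L /\
     forall r : R * R, r.1 = x ->
       (cost_vertical M N r <= weighted_dist M N L)%E) /\
  (forall y : R, exists L : posline R,
     candidate_line CM CN Omega L /\
     forall r : R * R, r.2 = y ->
       (cost_horizontal M N r <= weighted_dist M N L)%E).
Proof.
move=> _ _ nontriv PM PN Q.
(* For steep lines [kap] is inversion, as the direction (h, 1) passes through [0:1:1/h]; for flat
   ones it is the identity. *)
have inv_gt0 (t : R) : 0 < t -> 0 < t^-1 by rewrite invr_gt0.
split=> x.
- have [v /(_ x) [[L [Lc vL]] cvg_v]] :=
    line_family_candidate (@lval_steep R) (@mhat_steep R) (@on_steep R)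
      (@recip_steep_lt R) (@recip_steep_gt R) (@recip_steep_inf R)
      (@passes_steep R) inv_gt0 (invr1 R) nontriv PM PN Q.
  (* The limit is [v x] for every [r] on the line, so a single [L] serves all of them. *)
  exists L; split=> // r rx; suff -> : cost_vertical M N r = v x by [].
  apply: cvg_lim => //; apply: cvg_trans (cvg_v r.2); apply: near_eq_cvg.
  near=> t; rewrite steep_lineE ?rx //.
  by near: t; exact: near_right_unit.
- have [v /(_ x) [[L [Lc vL]] cvg_v]] :=
    line_family_candidate (@lval_flat R) (@mhat_flat R) (@on_flat R)
      (@recip_flat_lt R) (@recip_flat_gt R) (@recip_flat_inf R)
      (@passes_flat R) (fun _ h => h) erefl nontriv PM PN Q.
  exists L; split=> // r rx; suff -> : cost_horizontal M N r = v x by [].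
  apply: cvg_lim => //; apply: cvg_trans (cvg_v r.1); apply: near_eq_cvg.
  near=> t; rewrite flat_lineE ?rx //.
  by near: t; exact: near_right_unit.
Unshelve. all: by end_near. Qed.
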